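(* Suppose the stepsizes are $\alpha_k=\frac{\theta}{\mu(k+K)}$ for all $k\ge 0$ with $\theta>2$ and $K=\left\lceil\frac{2\theta(1+M)L^2}{\mu^2}\right\rceil$. Assume in addition that $\sum_{i=1}^n\|x_i(0)-x_*\|^2=\mathcal{O}(n)$ and $\sum_{i=1}^n\|\nabla f_i(x_* )\|^2=\mathcal{O}(n)$. Then it takes $K_T=\mathcal{O}\left(\frac{n}{(1-\rho_w)^2}\right)$ time for DSGD to reach the asymptotic rate of convergence, i.e., when $k\ge K_T$, $$\frac1n\sum_{i=1}^n\mathbb{E}\left[\|x_i(k)-x_*\|^2\right]\le\frac{\theta^2\bar M}{(2\theta-1)n\mu^2k}\,\mathcal{O}(1).$$ Explicitly: for all constants $a,b>0$ there are constants $C,C'>0$ depending only on $\theta,\mu,L,\sigma,M,a,b$ such that, whenever $\sum_i\|x_i(0)-x_*\|^2\le an$ and $\sum_i\|\nabla f_i(x_* )\|^2\le bn$, one has $\frac1n\sum_{i=1}^n\mathbb{E}[\|x_i(k)-x_*\|^2]\le C'\,\frac{\theta^2\bar M}{(2\theta-1)n\mu^2k}$ for all $k\ge C\frac{n}{(1-\rho_w)^2}$.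
   Context: Objectives: $n,p,m\ge 1$ are integers and $\mathcal N=\{1,\dots,n\}$. Each $f_i:\mathbb{R}^p\to\mathbb{R}$, $i\in\mathcal N$, is differentiable, $\mu$-strongly convex with $L$-Lipschitz gradient ($\mu,L>0$): $\langle\nabla f_i(x)-\nabla f_i(x'),x-x'\rangle\ge\mu\|x-x'\|^2$ and $\|\nabla f_i(x)-\nabla f_i(x')\|\le L\|x-x'\|$ for all $x,x'$. Let $f=\frac1n\sum_i f_i$; $x_*$ is its unique minimizer. Network: the agents interact over an undirected connected graph on $\mathcal N$. The mixing matrix $\mathbf W=[w_{ij}]\in\mathbb{R}^{n\times n}$ is nonnegative, satisfies $w_{ij},w_{ji}>0$ if $i,j$ are connected by an edge and $w_{ij}=w_{ji}=0$ otherwise ($i\ne j$), and is doubly stochastic: $\mathbf W\mathbf 1=\mathbf 1$, $\mathbf 1^\top\mathbf W=\mathbf 1^\top$. $\rho_w$ is the spectral norm of $\mathbf W-\frac1n\mathbf 1\mathbf 1^\top$, and $\rho_w<1$. Algorithm (DSGD): from arbitrary deterministic $x_i(0)\in\mathbb{R}^p$, $x_i(k+1)=\sum_{j=1}^n w_{ij}\left(x_j(k)-\alpha_k g_j(k)\right)$, $k\ge0$, where $g_j(k)=g_j(x_j(k),\xi_j(k))\in\mathbb{R}^p$ and $\xi_j(k)$ are random vectors in $\mathbb{R}^m$. Noise: let $\mathcal F(k)$ be the $\sigma$-algebra generated by $\{x_i(0),\dots,x_i(k): i\in\mathcal N\}$. For every $k\ge0$ the vectors $\xi_1(k),\dots,\xi_n(k)$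 are independent across $i$ conditionally on $\mathcal F(k)$, $\mathbb{E}[g_i(k)\mid\mathcal F(k)]=\nabla f_i(x_i(k))$, and $\mathbb{E}[\|g_i(k)-\nabla f_i(x_i(k))\|^2\mid\mathcal F(k)]\le\sigma^2+M\|\nabla f_i(x_i(k))\|^2$ for some constants $\sigma,M>0$. Notation: $\bar M=\frac{2M\sum_{i=1}^n\|\nabla f_i(x_* )\|^2}{n}+\sigma^2$. *)

(* Defs.v *)
From mathcomp Require Import all_boot all_order all_algebra.
From mathcomp Require Import all_classical all_reals all_analysis.

Set Implicit Arguments.
Unset Strict Implicit.
Unset Printing Implicit Defensive.

Import Order.TTheory GRing.Theory Num.Theory.
Import numFieldNormedType.Exports.

Local Open Scope classical_set_scope.
Local Open Scope ring_scope.

(* The library norm on matrices is the sup norm, so the Euclidean structure of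
   R^p, with R^p = 'cV[R]_p, is introduced explicitly. *)
Definition dotv (R : realType) (p : nat) (u v : 'cV[R]_p) : R :=
  \sum_(j < p) u j 0 * v j 0.

Definition enorm (R : realType) (p : nat) (v : 'cV[R]_p) : R :=
  Num.sqrt (dotv v v).

Definition spectral_norm (R : realType) (n : nat) (A : 'M[R]_n) : R :=
  sup [set enorm (A *m v) | v in [set v : 'cV[R]_n | enorm v <= 1]].

Definition grad (R : realType) (p : nat) (f : 'cV[R]_p -> R) (x : 'cV[R]_p) :
    'cV[R]_p :=
  \col_(j < p) 'D_(delta_mx j 0 : 'cV[R]_p) f x.

Record smooth_strongly_convex (R : realType) (p : nat) (mu L : R)
    (f : 'cV[R]_p -> R) : Prop := SmoothStronglyConvex {
  ssc_differentiable : forall x, differentiable f x ;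
  ssc_strongly_convex : forall x x',
    mu * enorm (x - x') ^+ 2 <= dotv (grad f x - grad f x') (x - x') ;
  ssc_lipschitz : forall x x',
    enorm (grad f x - grad f x') <= L * enorm (x - x')
}.

Definition avg_fun (R : realType) (n p : nat) (f : 'I_n -> 'cV[R]_p -> R)
    (x : 'cV[R]_p) : R :=
  n%:R^-1 * \sum_(i < n) f i x.

Definition is_minimizer (T : Type) (R : realType) (h : T -> R) (x : T) : Prop :=
  forall y, h x <= h y.

Record connected_graph (n : nat) (e : rel 'I_n) : Prop := ConnectedGraph {
  cg_symmetric : symmetric e ;
  cg_irreflexive : irreflexive e ;
  cg_connected : forall i j, connect e i j
}.

(* Meant for a symmetric irreflexive e: [mm_edge] then covers both w_ij and w_ji,
   and the diagonal of W is only required to be nonnegative. *)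
Record mixing_matrix (R : realType) (n : nat) (e : rel 'I_n) (W : 'M[R]_n) :
    Prop := MixingMatrix {
  mm_ge0 : forall i j, 0 <= W i j ;
  mm_edge : forall i j, e i j -> 0 < W i j ;
  mm_nonedge : forall i j, i != j -> ~~ e i j -> W i j = 0 ;
  mm_row : W *m const_mx 1 = const_mx 1 :> 'cV[R]_n ;
  mm_col : const_mx 1 *m W = const_mx 1 :> 'rV[R]_n
}.

Definition rho_w (R : realType) (n : nat) (W : 'M[R]_n) : R :=
  spectral_norm (W - n%:R^-1 *: (const_mx 1 : 'M[R]_n)).

(* Iterates of x_i(k+1) = sum_j w_ij (x_j(k) - alpha_k g_j(x_j(k), xi_j(k))). *)
Fixpoint dsgd (R : realType) (n p m : nat) (T : Type) (W : 'M[R]_n)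
    (alpha : nat -> R) (g : 'I_n -> 'cV[R]_p -> 'cV[R]_m -> 'cV[R]_p)
    (x0 : 'I_n -> 'cV[R]_p) (xi : 'I_n -> nat -> T -> 'cV[R]_m)
    (i : 'I_n) (k : nat) (w : T) : 'cV[R]_p :=
  match k with
  | 0 => x0 i
  | k'.+1 => \sum_(j < n) W i j *:
      (dsgd W alpha g x0 xi j k' w
       - alpha k' *: g j (dsgd W alpha g x0 xi j k' w) (xi j k' w))
  end.

Definition stepK (R : realType) (theta mu L M : R) : int :=
  Num.ceil (2 * theta * (1 + M) * L ^+ 2 / mu ^+ 2).

Definition stepsize (R : realType) (theta mu L M : R) (k : nat) : R :=
  theta / (mu * (k%:R + (stepK theta mu L M)%:~R)).

(* R^p with its Borel sigma-algebra, generated by the coordinate maps. *)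
Definition borel_vec (R : realType) (p : nat) :=
  g_sigma_algebraType (\bigcup_(j in [set: 'I_p])
    preimage_set_system setT (fun v : 'cV[R]_p => v j 0) measurable).

(* F(k) = sigma(x_i(t) : i, t <= k). *)
Definition history (R : realType) (n p : nat) (T : Type)
    (x : 'I_n -> nat -> T -> 'cV[R]_p) (k : nat) : set (set T) :=
  <<s \bigcup_(i in [set: 'I_n]) \bigcup_(t in [set t | (t <= k)%N])
      preimage_set_system setT (x i t : T -> borel_vec R p) measurable >>.

(* Y is a version of E[X | G], for a sub-sigma-algebra G. *)
Record is_cond_exp (d : measure_display) (T : measurableType d) (R : realType)
    (P : probability T R) (G : set (set T)) (X Y : T -> R) : Prop := IsCondExp {
  ce_integrable_l : P.-integrable setT (EFin \o X) ;
  ce_integrable_r : P.-integrable setT (EFin \o Y) ;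
  ce_adapted : forall B : set R, measurable B -> G (Y @^-1` B) ;
  ce_integral : forall A, G A ->
    (\int[P]_(w in A) (Y w)%:E = \int[P]_(w in A) (X w)%:E)%E
}.

(* Versions of conditional probabilities P(. | G) always exist and are a.s.
   unique, so the existential below does not depend on their choice; the product
   rule for subfamilies is the case where some of the B_i are the whole space. *)
Definition cond_independent (d : measure_display) (T : measurableType d)
    (R : realType) (P : probability T R) (G : set (set T)) (n m : nat)
    (z : 'I_n -> T -> 'cV[R]_m) : Prop :=
  forall B : 'I_n -> set (borel_vec R m), (forall i, measurable (B i)) ->
  exists q : 'I_n -> T -> R,
    (forall i, is_cond_exp P G (\1_(z i @^-1` B i)) (q i)) /\
    is_cond_exp P G (\1_(\bigcap_(i in [set: 'I_n]) (z i @^-1` B i)))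
      (fun w => \prod_(i < n) q i w).

(* Joint measurability of the g_i makes the g_i(x_i(k), xi_i(k)) random vectors
   that inherit the conditional independence of the xi_i(k). *)
Record gradient_noise (d : measure_display) (T : measurableType d)
    (R : realType) (P : probability T R) (n p m : nat)
    (f : 'I_n -> 'cV[R]_p -> R)
    (g : 'I_n -> 'cV[R]_p -> 'cV[R]_m -> 'cV[R]_p)
    (x : 'I_n -> nat -> T -> 'cV[R]_p) (xi : 'I_n -> nat -> T -> 'cV[R]_m)
    (sigma M : R) : Prop := GradientNoise {
  gn_measurable_xi : forall i k,
    measurable_fun setT (xi i k : T -> borel_vec R m) ;
  gn_measurable_g : forall i, measurable_fun setT
    (fun u : borel_vec R p * borel_vec R m => g i u.1 u.2 : borel_vec R p) ;
  gn_independent : forall k,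
    cond_independent P (history x k) (fun i => xi i k) ;
  gn_unbiased : forall i k (j : 'I_p),
    is_cond_exp P (history x k)
      (fun w => g i (x i k w) (xi i k w) j 0)
      (fun w => grad (f i) (x i k w) j 0) ;
  gn_variance : forall i k, exists V : T -> R,
    is_cond_exp P (history x k)
      (fun w => enorm (g i (x i k w) (xi i k w) - grad (f i) (x i k w)) ^+ 2) V
    /\ {ae P, forall w,
         V w <= sigma ^+ 2 + M * enorm (grad (f i) (x i k w)) ^+ 2}
}.

Definition Mbar (R : realType) (n p : nat) (f : 'I_n -> 'cV[R]_p -> R)
    (xs : 'cV[R]_p) (sigma M : R) : R :=
  2 * M * (\sum_(i < n) enorm (grad (f i) xs) ^+ 2) / n%:R + sigma ^+ 2.

(* Main.v *)
Require Import Defs.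
From mathcomp Require Import all_boot all_order all_algebra.
From mathcomp Require Import all_classical all_reals all_analysis.
From mathcomp Require Import measurable_realfun.
From mathcomp Require Import ring lra.
Import Order.TTheory GRing.Theory Num.Theory.
Import numFieldNormedType.Exports.
Local Open Scope classical_set_scope.
Local Open Scope ring_scope.
Set Implicit Arguments.
Unset Strict Implicit.
Unset Printing Implicit Defensive.

(** Let s = k + K, alpha = theta/(mu s), delta = 1 - rho_w. The proof follows three
    expected quantities along the iteration: the total error
    S = E sum_i |x_i - xs|^2, the dispersion V = E sum_i |x_i - xbar|^2 about the
    barycentre xbar, and the barycentre error U = E |xbar - xs|^2. They satisfy
    S = V + n U, and the claim is a bound on S/n = U + V/n.

    The barycentre is not moved by mixing, so it performs a stochastic gradient
    step along the average of the directions of the agents. The noises of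
    different agents are uncorrelated, hence the averaged noise has a second
    moment of order Mbar/n ([noise_avg_sqr]); this is the source of the leading
    term Mbar/(n k). The step differs from one for the mean objective only in
    that gradients are taken at the x_i instead of xbar, which costs a multiple of
    alpha V/n ([average_step_le], [bary_step]).

    The dispersion contracts by rho_w in each mixing, whereas the gradients create
    O(n alpha^2/delta) of new dispersion ([disp_step]); in balance,
    V = O(n/(delta^2 s^2)) ([V_decay]). This needs the second moments of the
    gradients to be O(n) uniformly in the network and from the first step on,
    which holds since K makes alpha so small that strong convexity absorbs the
    multiplicative part of the noise ([err_step], [S_bounded]).

    Inserting V, the barycentre error satisfies
      U(k+1) <= (1 - beta/s) U(k) + O(Mbar/n)/s^2 + O(1/delta^2)/s^3
    with beta = 1 + theta/2 > 2, whence U = O(Mbar/(n s)) + O(1/(delta^2 s^2))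
    ([average_recursion], [U_decay]). The second term and V/n are O(1/(delta k)^2),
    which is O(1/(n k)) once k >= n/delta^2, and Mbar >= sigma^2 makes this
    O(Mbar/(n k)). So C = 1 works ([dsgd_rate]).

    What remains is probability. The hypothesis of conditional independence
    concerns conditional probabilities of events; it is turned into orthogonality
    of the noises by testing on a pi-system ([pi_lambda_integral_eq0]) and by
    pulling out known factors ([integral_mul_eq0], [cond_indep_uncorrelated]). *)

Import HBNNSimple.

(** * Orthogonality to a sigma-algebra *)

Lemma integrable_measurable d (T : measurableType d) (R : realType)
    (P : probability T R) (X : T -> R) :
  P.-integrable setT (EFin \o X) -> measurable_fun setT X.
Proof. by move=> /integrableP[/measurable_EFinP]. Qed.

Lemma integrable_dom d (T : measurableType d) (R : realType)
    (P : probability T R) (X Y : T -> R) : measurable_fun setT X ->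
  P.-integrable setT (EFin \o Y) -> (forall w, `|X w| <= Y w) ->
  P.-integrable setT (EFin \o X).
Proof.
move=> mX iY XY; apply: (le_integrable _ _ _ iY) => //.
  exact/measurable_EFinP.
by move=> w _ /=; rewrite lee_fin (le_trans (XY w))// ler_norm.
Qed.

Lemma integrable_cstr d (T : measurableType d) (R : realType)
    (P : probability T R) (c : R) : P.-integrable setT (EFin \o (fun=> c)).
Proof. exact: (finite_measure_integrable_cst P c measurableT). Qed.

Lemma integrable_bounded d (T : measurableType d) (R : realType)
    (P : probability T R) (X : T -> R) (c : R) :
  measurable_fun setT X -> (forall w, `|X w| <= c) ->
  P.-integrable setT (EFin \o X).
Proof. by move=> mX; exact: integrable_dom (integrable_cstr P c). Qed.

Lemma integral_mul_indic_in d (T : measurableType d) (R : realType)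
    (P : probability T R) (X : T -> R) (A B : set T) :
  (\int[P]_(w in A) (X w * \1_B w)%:E = \int[P]_(w in A `&` B) (X w)%:E)%E.
Proof.
rewrite [RHS]integral_mkcondr; apply: eq_integral => w _.
rewrite patchE; case: ifPn => wA; first by rewrite indicE wA mulr1.
by rewrite indicE (negbTE wA) mulr0.
Qed.

Lemma integral_mul_indic d (T : measurableType d) (R : realType)
    (P : probability T R) (X : T -> R) (A : set T) :
  (\int[P]_w (X w * \1_A w)%:E = \int[P]_(w in A) (X w)%:E)%E.
Proof. by rewrite integral_mul_indic_in setTI. Qed.

Lemma integrable_mul_indic d (T : measurableType d) (R : realType)
    (P : probability T R) (X : T -> R) (A : set T) :
  measurable A -> P.-integrable setT (EFin \o X) ->
  P.-integrable setT (EFin \o (fun w => X w * \1_A w)).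
Proof.
move=> mA iX; apply: (le_integrable _ _ _ iX) => //.
  apply/measurable_EFinP; apply: measurable_funM => //.
  exact: integrable_measurable iX.
move=> w _ /=; rewrite lee_fin normrM ler_piMr// indicE.
by case: (w \in A); rewrite ?normr1 ?normr0.
Qed.

(** For a simple Y the integral of X Y is a finite combination of integrals of X
    over events of G, all zero. The simple approximations of a nonnegative Y
    that are measurable for G stay below Y, so that the integrable function
    |X Y| dominates the passage to the limit. *)
Lemma integral_mul_eq0_ge0 d (T : measurableType d) (R : realType)
    (P : probability T R) (G : set (set T)) (X Y : T -> R) :
  sigma_algebra setT G -> G `<=` measurable ->
  P.-integrable setT (EFin \o X) ->
  (forall A, G A -> (\int[P]_(w in A) (X w)%:E = 0)%E) ->
  (forall B : set R, measurable B -> G (Y @^-1` B)) -> (forall w, 0 <= Y w) ->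
  P.-integrable setT (EFin \o (fun w => X w * Y w)) ->
  (\int[P]_w (X w * Y w)%:E = 0)%E.
Proof.
move=> sG GM iX X0 aY Y0 iXY.
have mX : measurable_fun setT X by exact: integrable_measurable iX.
pose T' := g_sigma_algebraType G.
have mY' : measurable_fun setT (EFin \o (Y : T' -> R)).
  apply/measurable_EFinP => _ B mB; rewrite setTI.
  by apply: sub_sigma_algebra; exact: aY.
pose Yn n : {nnsfun T' >-> R} := nnsfun_approx measurableT mY' n.
(* the approximation takes place on T equipped with G *)
have cY w : (fun n => (Yn n w)%:E) @ \oo --> (Y w)%:E.
  by apply: cvg_nnsfun_approx => //= x _; rewrite lee_fin.
have cY' w : (fun n => Yn n w) @ \oo --> Y w by have /fine_cvgP[_] := cY w.
have leY n w : Yn n w <= Y w.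
  have nd : nondecreasing_seq (fun n => Yn n w).
    by move=> a b ab; exact/lefP/nd_nnsfun_approx.
  rewrite -(cvg_lim _ (cY' w))//; apply: nondecreasing_cvgn_le => //.
  by apply/cvg_ex; exists (Y w).
have GT A : <<s G >> A -> G A by rewrite sigma_algebra_id.
have GYn n B : measurable B -> G (Yn n @^-1` B).
  move=> mB; apply: GT; rewrite -[_ @^-1` _]setTI.
  exact: (@measurable_funPT _ _ _ _ (Yn n)).
have Yn0 n : (\int[P]_w (X w * Yn n w)%:E = 0)%E.
  under eq_integral => w _ do rewrite fimfunEord mulr_sumr -sumEFin.
  rewrite integral_sum//=; last first.
    move=> i; under eq_fun do rewrite mulrCA EFinM.
    by apply: integrableZl => //; apply: integrable_mul_indic => //; exact/GM/GYn.
  rewrite big1// => i _.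
  under eq_integral => w _ do rewrite mulrCA EFinM.
  rewrite integralZl//; last by apply: integrable_mul_indic => //; exact/GM/GYn.
  by rewrite integral_mul_indic X0 ?mule0//; exact: GYn.
have mYn n : measurable_fun setT (Yn n : T -> R).
  by move=> _ B mB; rewrite setTI; apply: GM; exact: GYn.
have mY : measurable_fun setT Y.
  by move=> _ B mB; rewrite setTI; apply: GM; exact: aY.
have lim0 : (\int[P]_w (X w * Yn n w)%:E)%E @[n --> \oo]
    --> (\int[P]_w (X w * Y w)%:E)%E.
  apply: (@dominated_cvg _ _ _ P setT measurableT
    (fun n w => (X w * Yn n w)%:E) _ (fun w => `|(X w * Y w)%:E|%E)) => //.
  - by move=> n; apply/measurable_EFinP; exact: measurable_funM.
  - move=> w _; apply: cvg_EFin; first exact: nearW.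
    by apply: cvgM; [exact: cvg_cst|exact: cY'].
  - exact: integrable_abse iXY.
  - move=> n w _; rewrite lee_fin !normrM ler_wpM2l//.
    by rewrite !ger0_norm//; exact: leY.
by move: lim0; under eq_fun do rewrite Yn0; move/(cvg_unique _ (cvg_cst _)) => <-.
Qed.

Lemma measurable_max0 (R : realType) :
  measurable_fun setT (fun r : R => Num.max r 0).
Proof. by apply: measurable_maxr; [exact: measurable_id|exact: measurable_cst]. Qed.

(** The pull-out property of conditional expectation in its centred form: if
    E[X | G] = 0, then X is orthogonal to everything that G determines. *)
Lemma integral_mul_eq0 d (T : measurableType d) (R : realType)
    (P : probability T R) (G : set (set T)) (X Y : T -> R) :
  sigma_algebra setT G -> G `<=` measurable ->
  P.-integrable setT (EFin \o X) ->
  (forall A, G A -> (\int[P]_(w in A) (X w)%:E = 0)%E) ->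
  (forall B : set R, measurable B -> G (Y @^-1` B)) ->
  P.-integrable setT (EFin \o (fun w => X w * Y w)) ->
  (\int[P]_w (X w * Y w)%:E = 0)%E.
Proof.
move=> sG GM iX X0 aY iXY.
have part (s : R) : `|s| = 1 ->
    P.-integrable setT (EFin \o (fun w => X w * Num.max (s * Y w) 0)) /\
    (\int[P]_w (X w * Num.max (s * Y w) 0)%:E = 0)%E.
  move=> s1.
  have mf : measurable_fun setT (fun r : R => Num.max (s * r) 0).
    by apply: (measurableT_comp (@measurable_max0 R)); exact: measurable_funM.
  have aY' B : measurable B -> G ((fun w => Num.max (s * Y w) 0) @^-1` B).
    move=> mB; have := aY _ (mf measurableT _ mB).
    by rewrite setTI.
  have iXY' : P.-integrable setT (EFin \o (fun w => X w * Num.max (s * Y w) 0)).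
    apply: (le_integrable _ _ _ iXY) => //.
      apply/measurable_EFinP; apply: measurable_funM.
        exact: integrable_measurable iX.
      by move=> _ B mB; rewrite setTI; apply: GM; exact: aY'.
    move=> w _; rewrite /= lee_fin !normrM ler_wpM2l//.
    rewrite ger0_norm ?le_max ?lexx ?orbT// ge_max normr_ge0 andbT.
    by rewrite (le_trans (ler_norm _))// normrM s1 mul1r.
  split=> //; apply: (integral_mul_eq0_ge0 sG GM iX X0 aY') => // w.
  by rewrite le_max lexx orbT.
have [i1 e1] := part 1 (normr1 _).
have [i2 e2] := part (-1) (normrN1 _).
rewrite (eq_integral (fun w => (X w * Num.max (1 * Y w) 0)%:E
    - (X w * Num.max (-1 * Y w) 0)%:E)%E).
  by rewrite (integralB _ i1 i2)// [X in (X - _)%E]e1 e2 sube0.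
move=> w _; rewrite -EFinB -mulrBr; congr (_ * _)%:E.
rewrite mul1r mulN1r; case: (leP 0 (Y w)) => Y0.
  by rewrite (@max_r _ _ (- Y w)) ?oppr_le0// subr0.
by rewrite (@max_l _ _ (- Y w)) ?oppr_ge0 ?ltW// sub0r opprK.
Qed.

(** The events on which X has integral zero form a Dynkin system. *)
Lemma pi_lambda_integral_eq0 d (T : measurableType d) (R : realType)
    (P : probability T R) (H : set (set T)) (X : T -> R) :
  P.-integrable setT (EFin \o X) -> setI_closed H -> H `<=` measurable ->
  H setT -> (forall A, H A -> (\int[P]_(w in A) (X w)%:E = 0)%E) ->
  forall A, <<s H>> A -> (\int[P]_(w in A) (X w)%:E = 0)%E.
Proof.
move=> iX HI HM HT X0.
pose D : set (set T) := [set A | measurable A /\ (\int[P]_(w in A) (X w)%:E = 0)%E].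
have iXA A : measurable A -> P.-integrable A (EFin \o X).
  by move=> mA; exact: integrableS iX.
have dynD : dynkin D.
  split.
  - by split=> //; exact: X0.
  - move=> A [mA A0]; split; first exact: measurableC.
    have := X0 _ HT; rewrite -(setUv A) integral_setU_EFin//.
    + by rewrite A0 add0e.
    + exact: measurableC.
    + by rewrite setUv; exact: integrable_measurable iX.
    + by rewrite disj_set2E setICr.
  - move=> F tF FD; split; first by apply: bigcupT_measurable => i; case: (FD i).
    rewrite integral_bigcup//; first by rewrite eseries0// => i _ _; case: (FD i).
      by move=> k; case: (FD k).
    by apply: iXA; apply: bigcupT_measurable => i; case: (FD i).
move=> A; rewrite -setI_closed_g_dynkin_g_sigma_algebra// => HA.
suff: D A by case.
by apply: HA; split => // B HB; split; [exact: HM|exact: X0].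
Qed.

(** Compare both sides on the event where Y exceeds Y', which belongs to G. *)
Lemma cond_exp_le d (T : measurableType d) (R : realType)
    (P : probability T R) (G : set (set T)) (X Y X' Y' : T -> R) :
  sigma_algebra setT G -> G `<=` measurable ->
  is_cond_exp P G X Y -> is_cond_exp P G X' Y' -> (forall w, X w <= X' w) ->
  {ae P, forall w, Y w <= Y' w}.
Proof.
move=> sG GM [iX iY aY eY] [iX' iY' aY' eY'] XX'.
pose T' := g_sigma_algebraType G.
have mT' (Z : T -> R) : (forall B, measurable B -> G (Z @^-1` B)) ->
    measurable_fun setT (Z : T' -> R).
  by move=> aZ _ B mB; rewrite setTI; apply: sub_sigma_algebra; exact: aZ.
have GT A : <<s G >> A -> G A by rewrite sigma_algebra_id.
pose A := [set w | 0 < Y w - Y' w].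
have GA : G A.
  apply: GT; have /(_ measurableT `]0, +oo[%classic) :=
    measurable_funB (mT' _ aY) (mT' _ aY').
  rewrite setTI => /(_ (measurable_itv _)).
  by congr (<<s _ >> _); apply/seteqP; split=> w /=; rewrite in_itv/= andbT.
have mA := GM _ GA.
have iYA Z : P.-integrable setT (EFin \o Z) -> P.-integrable A (EFin \o Z).
  by move=> iZ; exact: integrableS iZ.
have mD : measurable_fun A (fun w => (Y w - Y' w)%:E).
  apply/measurable_EFinP; apply: measurable_funTS; apply: measurable_funB.
    exact: integrable_measurable iY.
  exact: integrable_measurable iY'.
have leA : (\int[P]_(w in A) (Y w - Y' w)%:E <= 0)%E.
  under eq_integral do rewrite EFinB.
  rewrite integralB//; [|exact: iYA|exact: iYA].
  rewrite eY// eY'// sube_le0.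
  by apply: le_integral => //; [exact: iYA|exact: iYA|move=> w _; rewrite lee_fin].
have : (\int[P]_(w in A) `|(Y w - Y' w)%:E| = 0)%E.
  apply/eqP; rewrite eq_le integral_ge0// andbT.
  apply: le_trans leA; rewrite le_eqVlt; apply/orP; left; apply/eqP.
  by apply: eq_integral => w; rewrite inE /A/= => w0; rewrite gtr0_norm.
move/(ae_eq_integral_abs _ mA mD); apply: filterS => w /= wA.
rewrite leNgt; apply/negP => Yw; have w0 : 0 < Y w - Y' w by rewrite subr_gt0.
by have /eqP := wA w0; rewrite eqe gt_eqF.
Qed.

(** * From conditional independence to zero correlation *)

Lemma cond_exp_cst d (T : measurableType d) (R : realType)
    (P : probability T R) (G : set (set T)) (c : R) :
  sigma_algebra setT G -> is_cond_exp P G (cst c) (cst c).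
Proof.
move=> [G0 GC _]; split=> //; try exact: finite_measure_integrable_cst.
move=> B _; rewrite preimage_cst; case: ifP => _ //.
by rewrite -(setD0 setT); exact: GC.
Qed.

Lemma adapted_measurable (T : pointedType) (R : realType) (G : set (set T)) (Y : T -> R) :
  (forall B : set R, measurable B -> G (Y @^-1` B)) ->
  measurable_fun setT (Y : g_sigma_algebraType G -> R).
Proof.
by move=> aY _ B mB; rewrite setTI; apply: sub_sigma_algebra; exact: aY.
Qed.

Lemma measurable_adapted (T : pointedType) (R : realType) (G : set (set T)) (Y : T -> R) :
  sigma_algebra setT G -> measurable_fun setT (Y : g_sigma_algebraType G -> R) ->
  forall B : set R, measurable B -> G (Y @^-1` B).
Proof.
move=> sG mY B mB; have GT A : <<s G >> A -> G A by rewrite sigma_algebra_id.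
by apply: GT; have := mY measurableT _ mB; rewrite setTI.
Qed.

Lemma adapted_mul_indic (T : pointedType) (R : realType) (G : set (set T))
    (Y : T -> R) (A : set T) :
  sigma_algebra setT G -> (forall B : set R, measurable B -> G (Y @^-1` B)) -> G A ->
  forall B : set R, measurable B -> G ((fun w => Y w * \1_A w) @^-1` B).
Proof.
move=> sG aY GA; apply: (measurable_adapted sG); apply: measurable_funM.
  exact: adapted_measurable.
apply: (@measurable_indic _ (g_sigma_algebraType G)).
exact: sub_sigma_algebra.
Qed.

Lemma cond_exp_diff_eq0 d (T : measurableType d) (R : realType)
    (P : probability T R) (G : set (set T)) (X Y : T -> R) (A : set T) :
  G `<=` measurable -> is_cond_exp P G X Y -> G A ->
  (\int[P]_(w in A) (X w - Y w)%:E = 0)%E.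
Proof.
move=> GM [iX iY aY eY] GA; have mA := GM _ GA.
have iA Z : P.-integrable setT (EFin \o Z) -> P.-integrable A (EFin \o Z).
  by move=> iZ; exact: integrableS iZ.
under eq_integral do rewrite EFinB.
rewrite integralB//; [|exact: iA|exact: iA].
by rewrite eY// subee//; apply: integrable_fin_num => //; exact: iA.
Qed.

Lemma cond_exp_unique d (T : measurableType d) (R : realType)
    (P : probability T R) (G : set (set T)) (X Y Y' : T -> R) :
  sigma_algebra setT G -> G `<=` measurable ->
  is_cond_exp P G X Y -> is_cond_exp P G X Y' ->
  {ae P, forall w, Y w = Y' w}.
Proof.
move=> sG GM cY cY'.
have l1 := cond_exp_le sG GM cY cY' (fun w => lexx _).
have l2 := cond_exp_le sG GM cY' cY (fun w => lexx _).
by apply: filterS2 l1 l2 => w le1 le2; apply/eqP; rewrite eq_le le1 le2.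
Qed.

(** A version of a conditional probability lies in [0, 1] only almost surely;
    truncating it gives bounds that hold everywhere, hence integrable products. *)
Lemma cond_prob_clip d (T : measurableType d) (R : realType)
    (P : probability T R) (G : set (set T)) (U : set T) (q : T -> R) :
  sigma_algebra setT G -> G `<=` measurable ->
  is_cond_exp P G (\1_U) q ->
  exists q', [/\ is_cond_exp P G (\1_U) q', forall w, 0 <= q' w &
    forall w, q' w <= 1].
Proof.
move=> sG GM cq; have [i1 iq aq eq] := cq.
pose phi (r : R) : R := Num.max (Num.min r 1) 0.
have mphi : measurable_fun setT phi.
  by apply: measurable_maxr => //; apply: measurable_minr.
have aq' B : measurable B -> G ((phi \o q) @^-1` B).
  by move=> mB; have := aq _ (mphi measurableT _ mB); rewrite setTI.
have mq' : measurable_fun setT (phi \o q).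
  by move=> _ B mB; rewrite setTI; apply: GM; exact: aq'.
have q'0 w : 0 <= (phi \o q) w by rewrite /phi/= le_max lexx orbT.
have q'1 w : (phi \o q) w <= 1 by rewrite /phi/= ge_max ge_min lexx orbT ler01.
have qq' : {ae P, forall w, q w = (phi \o q) w}.
  have l0 : {ae P, forall w, 0 <= q w}.
    apply: (cond_exp_le sG GM (cond_exp_cst P 0 sG) cq) => w.
    by rewrite indicE; case: (w \in U).
  have l1 : {ae P, forall w, q w <= 1}.
    apply: (cond_exp_le sG GM cq (cond_exp_cst P 1 sG)) => w.
    by rewrite indicE; case: (w \in U).
  by apply: filterS2 l0 l1 => w w0 w1; rewrite /phi/= min_l// max_l.
exists (phi \o q); split=> //; split=> //.
  by apply: (@integrable_bounded _ _ _ _ _ 1) => // w; rewrite ger0_norm.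
move=> A GA; rewrite -eq//; apply: ae_eq_integral => //; first exact: GM.
- by apply/measurable_EFinP; apply: measurable_funTS.
- by apply/measurable_EFinP; apply: measurable_funTS; exact: integrable_measurable iq.
- by apply: filterS qq' => w e _; congr EFin; exact/esym.
Qed.

(** Conditional independence of two of the z's, read as: the conditional
    probability q of an event of z_i remains correct when tested against events
    determined by F and z_j together. The version q must be chosen before the
    event of z_j, whereas the hypothesis provides versions that depend on both;
    almost sure uniqueness reconciles them. *)
Lemma cond_indep_pair d (T : measurableType d) (R : realType)
    (P : probability T R) (F : set (set T)) (n m : nat)
    (z : 'I_n -> T -> 'cV[R]_m) (i j : 'I_n) (Bi : set (borel_vec R m)) :
  sigma_algebra setT F -> F `<=` measurable ->
  (forall l, measurable_fun setT (z l : T -> borel_vec R m)) ->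
  cond_independent P F z -> i != j -> measurable Bi ->
  exists q, [/\ is_cond_exp P F (\1_(z i @^-1` Bi)) q,
    forall w, 0 <= q w, forall w, q w <= 1 &
    forall (Bj : set (borel_vec R m)) A, measurable Bj -> F A ->
      (\int[P]_(w in A `&` z j @^-1` Bj) (\1_(z i @^-1` Bi) w - q w)%:E = 0)%E].
Proof.
move=> sF FM mz ind ij mBi.
have mU l (B : set (borel_vec R m)) : measurable B -> measurable (z l @^-1` B).
  by move=> mB; have := mz l measurableT _ mB; rewrite setTI.
have := ind (fun l => if l == i then Bi else setT).
case=> [l|q0 [/(_ i)]]; first by case: ifP.
rewrite eqxx => /(cond_prob_clip sF FM)[q [cq q0' q1]] _.
exists q; split=> // Bj A mBj FA.
pose C l := if l == i then Bi else if l == j then Bj else setT.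
(* events of the other z's are taken to be the whole space *)
have [l|q' [cq' cpq]] := ind C.
  by rewrite /C; case: ifP => // _; case: ifP.
have Ci : C i = Bi by rewrite /C eqxx.
have Cj : C j = Bj by rewrite /C eq_sym (negbTE ij) eqxx.
set Ui := z i @^-1` Bi; set Uj := z j @^-1` Bj.
have capU : \bigcap_(l in [set: 'I_n]) z l @^-1` C l = Ui `&` Uj.
  apply/seteqP; split=> [w Uw|w [wi wj] l _ /=].
    by split; [have := Uw i I|have := Uw j I]; rewrite /= ?Ci ?Cj.
  by rewrite /C; case: eqP => [->//|_]; case: eqP => [->//|_].
have := cq' j; rewrite Cj => /(cond_prob_clip sF FM)[qj [cqj qj0 qj1]].
pose r l := if l == i then q else if l == j then qj else cst 1.
have q'r l : {ae P, forall w, q' l w = r l w}.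
  have := cq' l; rewrite /C /r; case: eqP => [->|_] cq'l.
    exact: cond_exp_unique sF FM cq'l cq.
  move: cq'l; case: eqP => [->|_] cq'l.
    exact: cond_exp_unique sF FM cq'l cqj.
  apply: (cond_exp_unique sF FM cq'l).
  by rewrite preimage_setT indicT; exact: (cond_exp_cst P 1 sF).
have prodr w : \prod_(l < n) r l w = q w * qj w.
  rewrite (bigD1 i)//= (bigD1 j) 1?eq_sym//= /r eqxx eq_sym (negbTE ij) eqxx.
  rewrite big1 ?mulr1// => l /andP[li lj].
  by rewrite (negbTE li) (negbTE lj).
have pq : {ae P, forall w, \prod_(l < n) q' l w = q w * qj w}.
  have /filter_forall : forall l, {ae P, forall w, q' l w = r l w} by [].
  apply: filterS => w wl; rewrite -prodr.
  by apply: eq_bigr => l _; exact: wl.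
have mq : measurable_fun setT q.
  by apply: integrable_measurable; exact: ce_integrable_r cq.
have mqj : measurable_fun setT qj.
  by apply: integrable_measurable; exact: ce_integrable_r cqj.
have mUi : measurable Ui by exact: mU.
have mUj : measurable Uj by exact: mU.
have mA := FM _ FA.
have e1 : (\int[P]_(w in A) (\1_Ui w * \1_Uj w)%:E =
           \int[P]_(w in A) (q w * qj w)%:E)%E.
  have := ce_integral cpq FA; rewrite capU => e.
  under eq_integral => w _ do rewrite -[_ * _]/((\1_Ui \* \1_Uj) w) -indicI.
  rewrite -e; apply: ae_eq_integral => //.
  - apply/measurable_EFinP; apply: measurable_funTS; apply: integrable_measurable.
    exact: ce_integrable_r cpq.
  - by apply/measurable_EFinP; apply: measurable_funTS; exact: measurable_funM.
  - by apply: filterS pq => w /= -> _.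
have bd (f : T -> R) : measurable_fun setT f -> (forall w, 0 <= f w) ->
    (forall w, f w <= 1) -> P.-integrable setT (EFin \o f).
  by move=> mf f0 f1; apply: (@integrable_bounded _ _ _ _ _ 1) => // w; rewrite ger0_norm.
have I0 (U : set T) w : 0 <= (\1_U w : R) by rewrite indicE; case: (w \in U).
have I1 (U : set T) w : (\1_U w : R) <= 1 by rewrite indicE; case: (w \in U).
have e2 : (\int[P]_(w in A) (q w * \1_Uj w)%:E =
           \int[P]_(w in A) (q w * qj w)%:E)%E.
  have : (\int[P]_w ((\1_Uj w - qj w) * (q w * \1_A w))%:E = 0)%E.
    apply: (integral_mul_eq0 sF FM).
    - apply: (@integrable_bounded _ _ _ _ _ 1).
        by apply: measurable_funB => //; exact: measurable_indic.
      by move=> w; rewrite ler_norml; have := I0 Uj w; have := I1 Uj w;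
        have := qj0 w; have := qj1 w; lra.
    - by move=> A' FA'; exact: (cond_exp_diff_eq0 FM cqj).
    - exact: (adapted_mul_indic sF (ce_adapted cq) FA).
    - apply: (@integrable_bounded _ _ _ _ _ 1).
        apply: measurable_funM; first by apply: measurable_funB => //; exact: measurable_indic.
        by apply: measurable_funM => //; exact: measurable_indic.
      move=> w; rewrite normrM -[leRHS]mulr1 ler_pM// ?normrM -1?[leRHS]mulr1 ?ler_pM//.
      - by rewrite ler_norml; have := I0 Uj w; have := I1 Uj w;
          have := qj0 w; have := qj1 w; lra.
      - by rewrite ger0_norm.
      - by rewrite ger0_norm.
  under eq_integral => w _ do rewrite mulrA.
  rewrite integral_mul_indic.
  under eq_integral => w _ do rewrite mulrBl EFinB.
  have iq1 : P.-integrable A (EFin \o (fun w => \1_Uj w * q w)).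
    apply: (@integrableS _ _ _ _ setT) => //; apply: bd => [|w|w].
    - by apply: measurable_funM => //; exact: measurable_indic.
    - by rewrite mulr_ge0.
    - by rewrite mulr_ile1.
  have iq2 : P.-integrable A (EFin \o (fun w => qj w * q w)).
    apply: (@integrableS _ _ _ _ setT) => //; apply: bd => [|w|w].
    - exact: measurable_funM.
    - by rewrite mulr_ge0.
    - by rewrite mulr_ile1.
  rewrite (integralB mA iq1 iq2) => /eqP.
  rewrite sube_eq ?add0e//; last exact: (integrable_fin_num mA iq1).
  under [X in (X == _)%E -> _]eq_integral => w _ do rewrite /= mulrC.
  by under [X in (_ == X)%E -> _]eq_integral => w _ do rewrite /= mulrC; move/eqP.
rewrite -integral_mul_indic_in.
under eq_integral => w _ do rewrite mulrBl EFinB.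
have iIq (f : T -> R) : measurable_fun setT f -> (forall w, 0 <= f w) ->
    (forall w, f w <= 1) -> P.-integrable A (EFin \o (fun w => f w * \1_Uj w)).
  move=> mf f0 f1; apply: (@integrableS _ _ _ _ setT) => //; apply: bd => [|w|w].
  - by apply: measurable_funM => //; exact: measurable_indic.
  - by rewrite mulr_ge0.
  - by rewrite mulr_ile1.
have mIi : measurable_fun setT (\1_Ui : T -> R) by exact: measurable_indic.
rewrite (integralB mA (iIq _ mIi (I0 Ui) (I1 Ui)) (iIq _ mq q0' q1)).
rewrite [X in (X - _)%E]e1 [X in (_ - X)%E]e2 subee//.
by rewrite -e2; exact: (integrable_fin_num mA (iIq _ mq q0' q1)).
Qed.

(** A pi-system that generates the sigma-algebra of the events determined by F and
    z together; identities between integrals are tested on it. *)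
Definition rect_system d (U : measurableType d) (T : Type) (F : set (set T))
    (z : T -> U) : set (set T) :=
  [set A `&` z @^-1` B | A in F & B in measurable].

Lemma setI_closed_rect d (U : measurableType d) (T : pointedType) (F : set (set T))
    (z : T -> U) :
  sigma_algebra setT F -> setI_closed (rect_system F z).
Proof.
move=> sF _ _ [A FA [B mB <-]] [A' FA' [B' mB' <-]].
exists (A `&` A').
  have GT C : <<s F >> C -> F C by rewrite sigma_algebra_id.
  apply: GT; apply: (@measurableI _ (g_sigma_algebraType F));
    exact: sub_sigma_algebra.
exists (B `&` B'); first exact: measurableI.
by rewrite preimage_setI setIACA.
Qed.

Lemma rect_system_sub d (U : measurableType d) (T : Type) (F : set (set T))
    (z : T -> U) :
  F `<=` rect_system F z.
Proof.
by move=> A FA; exists A => //; exists setT => //; rewrite preimage_setT setIT.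
Qed.

Lemma rect_system_measurable d (U : measurableType d) d' (T : measurableType d')
    (F : set (set T)) (z : T -> U) :
  F `<=` measurable -> measurable_fun setT z -> rect_system F z `<=` measurable.
Proof.
move=> FM mz _ [A FA [B mB <-]]; apply: measurableI; first exact: FM.
by have := mz measurableT _ mB; rewrite setTI.
Qed.

(** If V depends on F and z_j and is centred given F, then it is still centred
    given F and z_i, hence orthogonal to U. By the pi-lambda argument it suffices
    to integrate V over an event A of F intersected with an event of z_i. There,
    the indicator of the latter may be replaced by its conditional probability q
    given F, because V depends on F and z_j only; what remains is E[V q 1_A],
    which vanishes as q 1_A is determined by F. *)
Lemma cond_indep_uncorrelated d (T : measurableType d) (R : realType)
    (P : probability T R) (F : set (set T)) (n m : nat)
    (z : 'I_n -> T -> 'cV[R]_m) (i j : 'I_n) (U V : T -> R) :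
  let S l := <<s rect_system F (z l : T -> borel_vec R m) >> in
  sigma_algebra setT F -> F `<=` measurable ->
  (forall l, measurable_fun setT (z l : T -> borel_vec R m)) ->
  cond_independent P F z -> i != j ->
  (forall B : set R, measurable B -> S i (U @^-1` B)) ->
  (forall B : set R, measurable B -> S j (V @^-1` B)) ->
  P.-integrable setT (EFin \o V) ->
  (forall A, F A -> (\int[P]_(w in A) (V w)%:E = 0)%E) ->
  P.-integrable setT (EFin \o (fun w => V w * U w)) ->
  (\int[P]_w (V w * U w)%:E = 0)%E.
Proof.
move=> S sF FM mz ind ij aU aV iV V0 iVU.
have sS l : sigma_algebra setT (S l) by exact: smallest_sigma_algebra.
have RM l : rect_system F (z l : T -> borel_vec R m) `<=` measurable.
  by apply: rect_system_measurable.
have FT : F setT by rewrite -(setD0 setT); case: sF => F0 FC _; exact: FC.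
have RT l : rect_system F (z l : T -> borel_vec R m) setT.
  exact: rect_system_sub.
have RI l : setI_closed (rect_system F (z l : T -> borel_vec R m)).
  exact: setI_closed_rect.
have SM l : S l `<=` measurable.
  by apply: smallest_sub; [exact: sigma_algebra_measurable|exact: RM].
have mV : measurable_fun setT V by exact: integrable_measurable iV.
apply: (integral_mul_eq0 (sS i) (SM i) iV _ aU iVU).
apply: (pi_lambda_integral_eq0 iV (RI i) (RM i) (RT i)).
move=> _ [A FA [Bi mBi <-]].
have [q [cq q0 q1 qB]] := cond_indep_pair sF FM mz ind ij mBi.
set Ui := z i @^-1` Bi in cq qB *.
have mA := FM _ FA.
have mUi : measurable Ui by have := mz i measurableT _ mBi; rewrite setTI.
have mq : measurable_fun setT q.
  by apply: integrable_measurable; exact: ce_integrable_r cq.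
have I0 w : 0 <= (\1_Ui w : R) by rewrite indicE; case: (w \in Ui).
have I1 w : (\1_Ui w : R) <= 1 by rewrite indicE; case: (w \in Ui).
have D1 w : `|\1_Ui w - q w| <= 1.
  by rewrite ler_norml; have := I0 w; have := I1 w; have := q0 w; have := q1 w; lra.
have mD : measurable_fun setT (fun w => \1_Ui w - q w).
  by apply: measurable_funB => //; exact: measurable_indic.
have iD := integrable_bounded P mD D1.
have iVA : P.-integrable setT (EFin \o (fun w => V w * \1_A w)).
  exact: integrable_mul_indic.
have iprod (f : T -> R) : measurable_fun setT f -> (forall w, `|f w| <= 1) ->
    P.-integrable setT (EFin \o (fun w => f w * (V w * \1_A w))).
  move=> mf f1; apply: (le_integrable _ _ _ iVA) => //.
    apply/measurable_EFinP; apply: measurable_funM => //.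
    exact: integrable_measurable iVA.
  by move=> w _ /=; rewrite lee_fin normrM ler_piMl.
have q1' w : `|q w| <= 1 by rewrite ger0_norm.
have I1' w : `|\1_Ui w : R| <= 1 by rewrite ger0_norm.
have mIi : measurable_fun setT (\1_Ui : T -> R) by exact: measurable_indic.
have SFA : S j A by apply: sub_sigma_algebra; exact: rect_system_sub.
have e1 : (\int[P]_w ((\1_Ui w - q w) * (V w * \1_A w))%:E = 0)%E.
  apply: (integral_mul_eq0 (sS j) (SM j) iD) (iprod _ mD D1).
    apply: (pi_lambda_integral_eq0 iD (RI j) (RM j) (RT j)).
    by move=> _ [A' FA' [Bj mBj <-]]; exact: qB.
  exact: (adapted_mul_indic (sS j) aV SFA).
have e2 : (\int[P]_w (V w * (q w * \1_A w))%:E = 0)%E.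
  apply: (integral_mul_eq0 sF FM iV V0) => //.
    exact: (adapted_mul_indic sF (ce_adapted cq) FA).
  by under eq_fun do rewrite mulrCA; exact: iprod.
rewrite -integral_mul_indic_in -integral_mul_indic.
move: e1; under eq_integral do rewrite mulrBl EFinB.
rewrite (integralB _ (iprod _ mIi I1') (iprod _ mq q1'))//.
rewrite [X in (_ - X)%E](_ : _ = 0%E); last first.
  by rewrite -e2; apply: eq_integral => w _ /=; rewrite mulrCA.
rewrite sube0 => e1; rewrite -[RHS]e1.
by apply: eq_integral => w _ /=; congr (_%:E); ring.
Qed.

(** * Euclidean algebra and mixing *)
Section Euclidean.
Context {R : realType} {p : nat}.
Implicit Types (u v w : 'cV[R]_p) (c : R).

Lemma dotvC u v : dotv u v = dotv v u.
Proof. by apply: eq_bigr => j _; rewrite mulrC. Qed.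

Lemma dotvDl u v w : dotv (u + v) w = dotv u w + dotv v w.
Proof. by rewrite -big_split; apply: eq_bigr => j _; rewrite !mxE mulrDl. Qed.

Lemma dotvZl c u v : dotv (c *: u) v = c * dotv u v.
Proof. by rewrite mulr_sumr; apply: eq_bigr => j _; rewrite !mxE mulrA. Qed.

Lemma dotv0l v : dotv 0 v = 0.
Proof. by rewrite -(scale0r 0) dotvZl mul0r. Qed.

Lemma dotvNl u v : dotv (- u) v = - dotv u v.
Proof. by rewrite -scaleN1r dotvZl mulN1r. Qed.

Lemma dotvDr u v w : dotv u (v + w) = dotv u v + dotv u w.
Proof. by rewrite !(dotvC u) dotvDl. Qed.

Lemma dotvZr c u v : dotv u (c *: v) = c * dotv u v.
Proof. by rewrite !(dotvC u) dotvZl. Qed.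

Lemma dotvNr u v : dotv u (- v) = - dotv u v.
Proof. by rewrite !(dotvC u) dotvNl. Qed.

Lemma dotv_suml n (x : 'I_n -> 'cV[R]_p) v :
  dotv (\sum_i x i) v = \sum_i dotv (x i) v.
Proof.
rewrite /dotv exchange_big; apply: eq_bigr => j _ /=.
by rewrite summxE mulr_suml.
Qed.

Lemma dotv_ge0 u : 0 <= dotv u u.
Proof. by apply: sumr_ge0 => j _; rewrite -expr2 sqr_ge0. Qed.

Lemma enorm_sqr u : enorm u ^+ 2 = dotv u u.
Proof. by rewrite sqr_sqrtr ?dotv_ge0. Qed.

Lemma enorm_ge0 u : 0 <= enorm u.
Proof. exact: sqrtr_ge0. Qed.

Lemma dotv_eq0 u : dotv u u = 0 -> u = 0.
Proof.
move=> /eqP; rewrite psumr_eq0 => [/allP u0|j _]; last by rewrite -expr2 sqr_ge0.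
apply/matrixP => j k; rewrite ord1 mxE; apply/eqP.
by have := u0 j (mem_index_enum _); rewrite /= -expr2 sqrf_eq0.
Qed.

Lemma dotv_young u v c : 0 < c ->
  2 * dotv u v <= c * dotv u u + c^-1 * dotv v v.
Proof.
move=> c0; have c1 : c^-1 * c = 1 by rewrite mulVf// gt_eqF.
have : 0 <= c^-1 * dotv (c *: u - v) (c *: u - v).
  by rewrite mulr_ge0 ?dotv_ge0// invr_ge0 ltW.
rewrite !(dotvDl, dotvDr, dotvZl, dotvZr, dotvNl, dotvNr) (dotvC v u).
rewrite (_ : _ * _ = c^-1 * c * c * dotv u u - 2 * (c^-1 * c) * dotv u v
  + c^-1 * dotv v v); last by ring.
by rewrite c1; lra.
Qed.

Lemma dotv_sqrD u v :
  dotv (u + v) (u + v) = dotv u u + 2 * dotv u v + dotv v v.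
Proof. by rewrite !dotvDl !dotvDr (dotvC v u); ring. Qed.

Lemma dotv_sqrB u v :
  dotv (u - v) (u - v) = dotv u u - 2 * dotv u v + dotv v v.
Proof. by rewrite dotv_sqrD !(dotvNl, dotvNr); ring. Qed.

Lemma dotv_sqrD_le u v :
  dotv (u + v) (u + v) <= 2 * dotv u u + 2 * dotv v v.
Proof.
by have := dotv_ge0 (u - v); rewrite dotv_sqrB dotv_sqrD; lra.
Qed.

End Euclidean.

Section Average.
Context {R : realType} {n p : nat}.
Implicit Types (x y : 'I_n -> 'cV[R]_p).

Definition avg x : 'cV[R]_p := n%:R^-1 *: \sum_i x i.

Hypothesis n_gt0 : (0 < n)%N.

Let n0 : n%:R != 0 :> R. Proof. by rewrite pnatr_eq0 -lt0n. Qed.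

(** Parallel axis identity: the deviations from the barycentre sum to zero, which
    removes the cross terms. *)
Lemma sum_sqdist_avg x z :
  \sum_i dotv (x i - z) (x i - z) =
  \sum_i dotv (x i - avg x) (x i - avg x) + n%:R * dotv (avg x - z) (avg x - z).
Proof.
have s0 : \sum_i (x i - avg x) = 0.
  rewrite sumrB /avg sumr_const card_ord -scaler_nat scalerA mulfV//.
  by rewrite scale1r subrr.
rewrite (eq_bigr (fun i => dotv (x i - avg x) (x i - avg x) +
    2 * dotv (x i - avg x) (avg x - z) + dotv (avg x - z) (avg x - z))); last first.
  by move=> i _; rewrite -dotv_sqrD addrA subrK.
rewrite !big_split/= -mulr_sumr -dotv_suml s0 sumr_const card_ord -[_ *+ n]mulr_natl.
by rewrite dotv0l mulr0 addr0.
Qed.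

Lemma dotv_avg_le x :
  dotv (avg x) (avg x) <= n%:R^-1 * \sum_i dotv (x i) (x i).
Proof.
have := sum_sqdist_avg x 0; rewrite subr0 => e.
rewrite ler_pdivlMl ?ltr0n//.
under [X in _ <= X]eq_bigr => i _ do rewrite -(subr0 (x i)).
by rewrite e lerDr sumr_ge0// => i _; exact: dotv_ge0.
Qed.

End Average.

(** A bound for the matrix A on scalar vectors passes to families of vectors,
    since A acts on each coordinate separately. *)
Lemma mulmx_family_le (R : realType) (n p : nat) (A : 'M[R]_n) (c : R)
    (y : 'I_n -> 'cV[R]_p) :
  (forall v : 'cV[R]_n, dotv (A *m v) (A *m v) <= c * dotv v v) ->
  \sum_i dotv (\sum_j A i j *: y j) (\sum_j A i j *: y j)
    <= c * \sum_j dotv (y j) (y j).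
Proof.
move=> cA; rewrite /dotv exchange_big [X in _ <= _ * X]exchange_big/= mulr_sumr.
apply: ler_sum => r _; pose v := \col_j y j r 0.
have Av i : (\sum_j A i j *: y j) r 0 = (A *m v) i 0.
  by rewrite mxE summxE; apply: eq_bigr => j _; rewrite !mxE.
have vE j : y j r 0 = v j 0 by rewrite mxE.
under eq_bigr => i _ do rewrite Av.
by under [X in _ <= _ * X]eq_bigr => j _ do rewrite vE; exact: cA.
Qed.

Section Mixing.
Context {R : realType} {n : nat} {e : rel 'I_n} {W : 'M[R]_n}.
Hypothesis n_gt0 : (0 < n)%N.
Hypothesis mW : mixing_matrix e W.

Lemma mixing_row i : \sum_j W i j = 1.
Proof.
have /matrixP/(_ i 0) := mm_row mW; rewrite !mxE => <-.
by apply: eq_bigr => j _; rewrite mxE mulr1.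
Qed.

Lemma mixing_col j : \sum_i W i j = 1.
Proof.
have /matrixP/(_ 0 j) := mm_col mW; rewrite !mxE => <-.
by apply: eq_bigr => i _; rewrite mxE mul1r.
Qed.

(** Jensen's inequality in each row of W; the sum over rows then uses that the
    columns of W sum to one. *)
Lemma mixing_contract (v : 'cV[R]_n) : dotv (W *m v) (W *m v) <= 1 * dotv v v.
Proof.
have jensen i : (W *m v) i 0 * (W *m v) i 0 <= \sum_j W i j * (v j 0) ^+ 2.
  set m := (W *m v) i 0.
  have em : m = \sum_j W i j * v j 0 by rewrite /m mxE.
  have : 0 <= \sum_j W i j * (v j 0 - m) ^+ 2.
    by apply: sumr_ge0 => j _; rewrite mulr_ge0 ?(mm_ge0 mW)// sqr_ge0.
  rewrite (eq_bigr (fun j => W i j * (v j 0) ^+ 2 +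
      (- 2 * m) * (W i j * v j 0) + m ^+ 2 * W i j)); last by move=> j _; ring.
  by rewrite !big_split/= -!mulr_sumr mixing_row -em; lra.
rewrite mul1r (le_trans (ler_sum _ (fun i _ => jensen i)))//.
rewrite exchange_big/= le_eqVlt; apply/orP; left; apply/eqP/eq_bigr => j _.
by rewrite -mulr_suml mixing_col mul1r expr2.
Qed.

Lemma avg_mixing p (y : 'I_n -> 'cV[R]_p) :
  avg (fun i => \sum_j W i j *: y j) = avg y.
Proof.
congr (_ *: _); rewrite exchange_big/=; apply: eq_bigr => j _.
by rewrite -scaler_suml mixing_col scale1r.
Qed.

Lemma mixing_shift p (y : 'I_n -> 'cV[R]_p) z i :
  \sum_j W i j *: (y j - z) = \sum_j W i j *: y j - z.
Proof.
under eq_bigr do rewrite scalerBr.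
by rewrite sumrB -scaler_suml mixing_row scale1r.
Qed.

Lemma mixing_sqdist_le p (y : 'I_n -> 'cV[R]_p) z :
  \sum_i dotv (\sum_j W i j *: y j - z) (\sum_j W i j *: y j - z)
    <= \sum_j dotv (y j - z) (y j - z).
Proof.
have := mulmx_family_le (fun j => y j - z) mixing_contract.
by rewrite mul1r; under eq_bigr do rewrite mixing_shift.
Qed.

End Mixing.

Section Spectral.
Context {R : realType} {n : nat}.
Implicit Types (A : 'M[R]_n) (v : 'cV[R]_n).

Lemma enormZ (c : R) v : enorm (c *: v) = `|c| * enorm v.
Proof.
by rewrite /enorm dotvZl dotvZr mulrA -expr2 sqrtrM ?sqr_ge0// sqrtr_sqr.
Qed.

Lemma enorm0 : enorm (0 : 'cV[R]_n) = 0.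
Proof. by rewrite -(scale0r 0) enormZ normr0 mul0r. Qed.

Let unit_image A := [set enorm (A *m v) | v in [set v : 'cV[R]_n | enorm v <= 1]].

(** The supremum that defines the spectral norm is an upper bound only once the
    set is known to be bounded; the entries of A give a crude bound. *)
Lemma unit_image_ubound A : has_ubound (unit_image A).
Proof.
exists (Num.sqrt (\sum_i (\sum_j `|A i j|) ^+ 2)) => _ [v /= v1 <-].
apply: ler_wsqrtr; apply: ler_sum => i _; rewrite -expr2.
have vj j : `|v j 0| <= 1.
  rewrite -(@ler_pXn2r _ 2) ?nnegrE// expr1n real_normK ?num_real//.
  have : enorm v ^+ 2 <= 1 by rewrite expr_le1 ?enorm_ge0.
  apply: le_trans; rewrite enorm_sqr /dotv (bigD1 j)//= -expr2 lerDl sumr_ge0// => l _.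
  by rewrite -expr2 sqr_ge0.
rewrite -(real_normK (num_real _)) ler_pXn2r ?nnegrE ?normr_ge0 ?sumr_ge0//.
rewrite mxE (le_trans (ler_norm_sum _ _ _))//; apply: ler_sum => j _.
by rewrite normrM ler_piMr.
Qed.

Lemma spectral_norm_ge0 A : 0 <= spectral_norm A.
Proof.
apply: ub_le_sup; first exact: unit_image_ubound.
by exists 0 => /=; rewrite ?mulmx0 enorm0.
Qed.

Lemma spectral_norm_sqr A v :
  dotv (A *m v) (A *m v) <= spectral_norm A ^+ 2 * dotv v v.
Proof.
have [v0|v0] := eqVneq (dotv v v) 0.
  by rewrite (dotv_eq0 v0) mulmx0 !dotv0l mulr0.
have N0 : 0 < enorm v by rewrite sqrtr_gt0 lt_neqAle eq_sym v0 dotv_ge0.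
have : enorm (A *m ((enorm v)^-1 *: v)) <= spectral_norm A.
  apply: ub_le_sup; first exact: unit_image_ubound.
  exists ((enorm v)^-1 *: v) => //=.
  by rewrite enormZ ger0_norm ?invr_ge0 ?enorm_ge0// mulVf ?gt_eqF.
rewrite -scalemxAr enormZ ger0_norm ?invr_ge0 ?enorm_ge0// ler_pdivrMl// => le.
rewrite -!enorm_sqr -exprMn ler_sqr ?nnegrE ?mulr_ge0 ?enorm_ge0 ?spectral_norm_ge0//.
by rewrite mulrC.
Qed.

End Spectral.

(** Subtracting the barycentre after mixing amounts to applying W - J, with J the
    averaging matrix, and W - J annihilates constant families; hence z is free. *)
Lemma consensus_contract (R : realType) (n p : nat) (e : rel 'I_n) (W : 'M[R]_n)
    (y : 'I_n -> 'cV[R]_p) z :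
  (0 < n)%N -> mixing_matrix e W ->
  \sum_i dotv (\sum_j W i j *: y j - avg y) (\sum_j W i j *: y j - avg y)
    <= rho_w W ^+ 2 * \sum_j dotv (y j - z) (y j - z).
Proof.
move=> n_gt0 mW; have n0 : n%:R != 0 :> R by rewrite pnatr_eq0 -lt0n.
have := mulmx_family_le (fun j => y j - z) (spectral_norm_sqr _).
move=> /(_ (W - n%:R^-1 *: (const_mx 1 : 'M[R]_n))).
rewrite -/(rho_w W).
under eq_bigr => i _.
  rewrite (_ : \sum_j _ = \sum_j W i j *: y j - avg y); first over.
  under eq_bigr => j _ do rewrite !mxE mulr1 scalerBl.
  rewrite sumrB (mixing_shift mW) -scaler_sumr sumrB sumr_const card_ord.
  rewrite scalerBr -/(avg y) -[z *+ n]scaler_nat scalerA mulVf// scale1r.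
  by rewrite opprB addrA subrK.
by [].
Qed.

(** * Gradients and one deterministic step *)

Section Objective.
Context {R : realType} {n p : nat} {mu L : R} {f : 'I_n -> 'cV[R]_p -> R}.
Hypothesis ssc : forall i, smooth_strongly_convex mu L (f i).
Hypothesis L_gt0 : 0 < L.

Lemma grad_monotone i x x' :
  mu * dotv (x - x') (x - x') <= dotv (grad (f i) x - grad (f i) x') (x - x').
Proof. by rewrite -enorm_sqr; exact: ssc_strongly_convex. Qed.

Lemma grad_lipschitz i x x' :
  dotv (grad (f i) x - grad (f i) x') (grad (f i) x - grad (f i) x')
    <= L ^+ 2 * dotv (x - x') (x - x').
Proof.
rewrite -!enorm_sqr -exprMn ler_pXn2r ?nnegrE ?mulr_ge0 ?enorm_ge0 ?(ltW L_gt0)//.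
exact: ssc_lipschitz.
Qed.

Lemma grad_sqr_le i x xs :
  dotv (grad (f i) x) (grad (f i) x) <= 2 * L ^+ 2 * dotv (x - xs) (x - xs) +
    2 * dotv (grad (f i) xs) (grad (f i) xs).
Proof.
have := dotv_sqrD_le (grad (f i) x - grad (f i) xs) (grad (f i) xs).
by rewrite subrK; have := grad_lipschitz i x xs; lra.
Qed.

(** Compare strong monotonicity and the Lipschitz bound on one nonzero
    displacement. *)
Lemma mu_le_L : (0 < n)%N -> (0 < p)%N -> mu <= L.
Proof.
case: n f ssc => // n' f' ssc' _; case: p f' ssc' => // p' f' ssc' _.
pose x : 'cV[R]_p'.+1 := const_mx 1.
have x1 : 0 < dotv (x - 0) (x - 0).
  rewrite subr0 /dotv (eq_bigr (fun=> 1)) ?sumr_const ?card_ord ?ltr0n//.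
  by move=> j _; rewrite mxE mulr1.
have m := ssc_strongly_convex (ssc' ord0) x 0.
have l := ssc_lipschitz (ssc' ord0) x 0.
have y := dotv_young (x - 0) (grad (f' ord0) x - grad (f' ord0) 0) L_gt0.
rewrite -(ler_pM2r x1); rewrite enorm_sqr in m.
have l2 : dotv (grad (f' ord0) x - grad (f' ord0) 0)
    (grad (f' ord0) x - grad (f' ord0) 0) <= L * L * dotv (x - 0) (x - 0).
  rewrite -!enorm_sqr -expr2 -exprMn.
  by rewrite ler_pXn2r ?nnegrE ?mulr_ge0 ?enorm_ge0 ?(ltW L_gt0).
have Li : 0 <= L^-1 by rewrite invr_ge0 ltW.
have l3 := ler_wpM2l Li l2.
rewrite mulrA (mulrA L^-1) mulVf ?mul1r ?gt_eqF// in l3.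
by rewrite dotvC in m; lra.
Qed.

(** First-order optimality, along each coordinate line through the minimizer. *)
Lemma sum_grad_minimizer xs : (0 < n)%N ->
  is_minimizer (avg_fun f) xs -> \sum_i grad (f i) xs = 0.
Proof.
move=> n_gt0 min.
have n0 : n%:R != 0 :> R by rewrite pnatr_eq0 -lt0n.
have df x : differentiable (avg_fun f) x.
  rewrite (_ : avg_fun f = n%:R^-1 *: \sum_(i < n) f i); last first.
    by apply/funext => y; rewrite /avg_fun/= fct_sumE.
  apply: differentiableZ; apply: differentiable_sum => i.
  exact: ssc_differentiable (ssc i) x.
apply/matrixP => j k; rewrite ord1 mxE summxE.
pose v : 'cV[R]_p := delta_mx j 0.
pose h (t : R) := avg_fun f (t *: v + xs).
have hD (t : R) : (fun s : R => s^-1 *: ((h \o shift t) (s *: 1) - h t)) =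
   (fun s : R => s^-1 *: ((avg_fun f \o shift (t *: v + xs)) (s *: v)
      - avg_fun f (t *: v + xs))).
  by apply/funext => s; rewrite /h/= [_ *: 1]mulr1 scalerDl addrA.
have h0 : is_derive (0 : R) 1 h 0.
  apply: (@derive1_at_min _ h (-1) 1) => [|t _||t _].
  - lra.
  - by rewrite /derivable hD; exact: diff_derivable.
  - by rewrite in_itv/=; apply/andP; split; lra.
  - by rewrite /h scale0r add0r; exact: min.
have : 'D_v (avg_fun f) xs = 0.
  by have := @derive_val _ _ _ _ _ _ _ h0; rewrite /derive hD scale0r add0r.
have -> : 'D_v (avg_fun f) xs = n%:R^-1 * \sum_i 'D_v (f i) xs.
  rewrite (_ : avg_fun f = n%:R^-1 *: \sum_(i < n) f i); last first.
    by apply/funext => y; rewrite /avg_fun/= fct_sumE.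
  rewrite deriveZ.
    rewrite derive_sum// => i.
    by apply: diff_derivable; exact: ssc_differentiable (ssc i) xs.
  apply: derivable_sum => i.
  by apply: diff_derivable; exact: ssc_differentiable (ssc i) xs.
move/eqP; rewrite mulf_eq0 invr_eq0 (negbTE n0)/= => /eqP s0.
by rewrite -[RHS]s0; apply: eq_bigr => i _; rewrite mxE.
Qed.

End Objective.

Section OneStep.
Context {R : realType} {n p : nat} {mu L : R} {f : 'I_n -> 'cV[R]_p -> R}.
Hypothesis ssc : forall i, smooth_strongly_convex mu L (f i).
Hypothesis mu_gt0 : 0 < mu.
Hypothesis L_gt0 : 0 < L.
Variables (xs : 'cV[R]_p) (al : R).
Hypothesis al_ge0 : 0 <= al.

(** The left-hand side is the expected squared distance after a stochastic step
    of one agent, apart from the variance floor: the factor 1 + M accounts for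
    the part of the variance that grows with the gradient. Of the decrease
    2 al mu due to monotonicity, al mu pays for the squared gradient, by the
    restriction on al, and al mu / 2 for the gradient of f_i at xs, which need not
    vanish. *)
Lemma agent_step_le (M : R) i x : 0 <= M -> al * (2 * (1 + M) * L ^+ 2) <= mu ->
  dotv (x - xs) (x - xs) - 2 * al * dotv (grad (f i) x) (x - xs)
    + al ^+ 2 * (1 + M) * dotv (grad (f i) x) (grad (f i) x)
  <= (1 - al * mu / 2) * dotv (x - xs) (x - xs)
     + al * (2 / mu + mu / L ^+ 2) * dotv (grad (f i) xs) (grad (f i) xs).
Proof.
move=> M0 al_le.
have m := grad_monotone ssc i x xs.
have G := grad_sqr_le ssc L_gt0 i x xs.
have c0 : 0 < mu / 2 by rewrite divr_gt0.
have y := dotv_young (x - xs) (- grad (f i) xs) c0.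
rewrite dotvDl dotvNl in m; rewrite dotvNr dotvNl dotvNr opprK in y.
rewrite (dotvC (x - xs)) invf_div in y.
have N0 := dotv_ge0 (x - xs); have g0 := dotv_ge0 (grad (f i) xs).
set N := dotv (x - xs) _ in m G y N0 *.
set g := dotv (grad (f i) xs) (grad _ _) in G y g0 *.
set GG := dotv (grad (f i) x) (grad _ _) in G *.
set q := dotv (grad (f i) xs) (x - xs) in m y.
set r := dotv (grad (f i) x) (x - xs) in m *.
have aG : al ^+ 2 * (1 + M) * GG <= al ^+ 2 * (1 + M) * (2 * L ^+ 2 * N + 2 * g).
  by apply: ler_wpM2l G; rewrite mulr_ge0 ?sqr_ge0 ?addr_ge0.
have aN : al * (al * (2 * (1 + M) * L ^+ 2)) * N <= al * mu * N.
  by apply: ler_wpM2r => //; exact: ler_wpM2l.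
have ag : al * (al * (2 * (1 + M))) * g <= al * (mu / L ^+ 2) * g.
  apply: ler_wpM2r => //; apply: ler_wpM2l => //.
  by rewrite ler_pdivlMr ?exprn_gt0// -mulrA.
have am : al * (mu * N) <= al * (r - q) by exact: ler_wpM2l.
have ay : al * (2 * - q) <= al * (mu / 2 * N + 2 / mu * g) by exact: ler_wpM2l.
lra.
Qed.

(** A gradient step of the mean objective at the barycentre contracts with
    factor 1 - 2 al mu + al^2 L^2. The gradients are taken at the agents instead,
    which causes a squared error of at most L^2 times the mean dispersion; by
    Young's inequality with weight eps mu, only eps al mu of the contraction is
    spent on it. *)
Lemma average_step_le (x : 'I_n -> 'cV[R]_p) (eps : R) : (0 < n)%N ->
  \sum_i grad (f i) xs = 0 -> 0 < eps -> al * L ^+ 2 <= 2 * mu ->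
  dotv (avg x - xs - al *: avg (fun i => grad (f i) (x i)))
       (avg x - xs - al *: avg (fun i => grad (f i) (x i))) <=
  (1 - 2 * al * mu + al ^+ 2 * L ^+ 2 + eps * al * mu)
    * dotv (avg x - xs) (avg x - xs) +
  (al ^+ 2 + al / (eps * mu)) * (L ^+ 2 / n%:R)
    * \sum_i dotv (x i - avg x) (x i - avg x).
Proof.
move=> n_gt0 s0 e0 al_le.
set r := avg x - xs; set gr := avg (fun i => grad (f i) (x i)).
set X := \sum_i _.
have n0 : 0 < n%:R^-1 :> R by rewrite invr_gt0 ltr0n.
pose F := avg (fun i => grad (f i) (avg x)).
have Fs : F = avg (fun i => grad (f i) (avg x) - grad (f i) xs).
  by rewrite /F /avg sumrB s0 subr0.
have X0 : 0 <= X by apply: sumr_ge0 => i _; exact: dotv_ge0.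
have D : dotv (F - gr) (F - gr) <= L ^+ 2 / n%:R * X.
  rewrite (_ : F - gr = avg (fun i => grad (f i) (avg x) - grad (f i) (x i))); last first.
    by rewrite /F /gr /avg sumrB scalerBr.
  rewrite (le_trans (dotv_avg_le n_gt0 _))// [L ^+ 2 / _]mulrC -mulrA ler_pM2l//.
  rewrite mulr_sumr; apply: ler_sum => i _.
  rewrite (le_trans (grad_lipschitz ssc L_gt0 _ _ _))//.
  by rewrite -[in leRHS]opprB dotvNl dotvNr opprK.
have F2 : dotv F F <= L ^+ 2 * dotv r r.
  rewrite Fs (le_trans (dotv_avg_le n_gt0 _))// ler_pdivrMl ?ltr0n//.
  have : \sum_(i < n) dotv (grad (f i) (avg x) - grad (f i) xs)
      (grad (f i) (avg x) - grad (f i) xs) <= \sum_(i < n) L ^+ 2 * dotv r r.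
    by apply: ler_sum => i _; exact: grad_lipschitz.
  by rewrite sumr_const card_ord -[_ *+ n]mulr_natl.
have Fr : mu * dotv r r <= dotv F r.
  rewrite Fs /avg dotvZl ler_pdivlMl ?ltr0n// dotv_suml.
  have : \sum_(i < n) mu * dotv r r <=
      \sum_(i < n) dotv (grad (f i) (avg x) - grad (f i) xs) r.
    by apply: ler_sum => i _; exact: grad_monotone.
  by rewrite sumr_const card_ord -[_ *+ n]mulr_natl.
have r0 := dotv_ge0 r.
have desc : dotv (r - al *: F) (r - al *: F) <=
    (1 - 2 * al * mu + al ^+ 2 * L ^+ 2) * dotv r r.
  rewrite dotv_sqrB dotvZr dotvZl dotvZr (dotvC r).
  have := ler_wpM2l al_ge0 Fr.
  by have := ler_wpM2l (sqr_ge0 al) F2; lra.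
have desc1 : dotv (r - al *: F) (r - al *: F) <= dotv r r.
  rewrite (le_trans desc)// -[leRHS]mul1r ler_wpM2r//.
  by have := ler_wpM2l al_ge0 al_le; lra.
rewrite (_ : r - al *: gr = (r - al *: F) + al *: (F - gr)); last first.
  by rewrite scalerBr addrA subrK.
rewrite dotv_sqrD dotvZr dotvZl dotvZr.
have em0 : 0 < eps * mu by rewrite mulr_gt0.
have y := ler_wpM2l al_ge0 (dotv_young (r - al *: F) (F - gr) em0).
have hD := ler_wpM2l (sqr_ge0 al) D.
have hDe : al * ((eps * mu)^-1 * dotv (F - gr) (F - gr)) <=
    al * ((eps * mu)^-1 * (L ^+ 2 / n%:R * X)).
  by apply: ler_wpM2l => //; rewrite ler_pM2l ?invr_gt0.
have hd := ler_wpM2l (mulr_ge0 al_ge0 (ltW em0)) desc1.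
lra.
Qed.

End OneStep.

(** * Scalar recursions with step sizes proportional to 1/(k + K) *)
Section Recursions.
Context {R : realType}.
Variable (K : R).
Hypothesis K_gt0 : 0 < K.
Local Notation s k := (k%:R + K).

Lemma shift_gt0 k : 0 < s k.
Proof. by rewrite ltr_wpDl. Qed.

Lemma shiftS k : s k.+1 = s k + 1.
Proof. by rewrite -natr1 addrAC. Qed.

Lemma bounded_recursion (S : nat -> R) (t : nat -> R) (c D : R) :
  (forall k, 0 <= t k) -> (forall k, t k <= 1) -> S 0%N <= D -> c <= D ->
  (forall k, S k.+1 <= (1 - t k) * S k + t k * c) -> forall k, S k <= D.
Proof.
move=> t0 t1 S0 cD rec; elim=> // k IH; apply: (le_trans (rec k)).
have h1 : (1 - t k) * S k <= (1 - t k) * D by apply: ler_wpM2l => //; rewrite subr_ge0.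
have h2 : t k * c <= t k * D by apply: ler_wpM2l.
lra.
Qed.

(** While (1 - rho)(k + K) < 4, the uniform bound D already is of the claimed
    order. Afterwards one contraction by rho leaves a margin (1 - rho)/2 that
    exceeds the relative decrease of 1/(k + K)^2 in one step. *)
Lemma consensus_recursion (V : nat -> R) (D B rho : R) :
  0 <= rho -> rho < 1 -> 0 <= D -> 0 <= B ->
  (forall k, V k <= D) ->
  (forall k, V k.+1 <= rho * V k + B / ((1 - rho) * s k ^+ 2)) ->
  forall k, V k <= (16 * D + D * K ^+ 2 + 2 * B) / ((1 - rho) ^+ 2 * s k ^+ 2).
Proof.
move=> rho0 rho1 D0 B0 VD rec.
set E := 16 * D + _ + _; set del := 1 - rho.
have d0 : 0 < del by rewrite subr_gt0.
have d1 : del <= 1 by rewrite /del; lra.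
have DK0 : 0 <= D * K ^+ 2 by rewrite mulr_ge0 ?sqr_ge0.
have E0 : 0 <= E by rewrite /E; lra.
elim=> [|k IH].
  rewrite (le_trans (VD 0%N))// add0r ler_pdivlMr ?mulr_gt0 ?exprn_gt0//.
  rewrite mulrCA (@le_trans _ _ (D * K ^+ 2))//; last by rewrite /E; lra.
  by rewrite ler_piMl// exprn_ile1// ltW.
have s0 := shift_gt0 k; rewrite shiftS; set sk := s k in s0 IH *.
have s1 : 0 < sk + 1 by rewrite addr_gt0.
have [small|large] := ltP (del * (sk + 1)) 4.
  rewrite (le_trans (VD k.+1))// ler_pdivlMr ?mulr_gt0 ?exprn_gt0//.
  rewrite -exprMn (@le_trans _ _ (D * 16))//; last by rewrite /E; lra.
  apply: ler_wpM2l => //.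
  have -> : 16 = 4 ^+ 2 :> R by ring.
  by rewrite ler_pXn2r ?nnegrE ?ltW// mulr_gt0.
apply: (le_trans (rec k)).
apply: (@le_trans _ _ (E * (1 - del / 2) / (del ^+ 2 * sk ^+ 2))).
  have h : rho * V k <= rho * (E / (del ^+ 2 * sk ^+ 2)) by exact: ler_wpM2l.
  apply: (le_trans (lerD h (lexx _))); rewrite -/sk -/del.
  rewrite (_ : rho * _ + _ = (rho * E + B * del) / (del ^+ 2 * sk ^+ 2)); last first.
    by field; rewrite !gt_eqF.
  rewrite ler_pM2r ?invr_gt0 ?mulr_gt0 ?exprn_gt0//.
  have -> : rho = 1 - del by rewrite /del; lra.
  have : 2 * B * del <= E * del by rewrite ler_pM2r// /E; lra.
  lra.
rewrite -[leLHS]mulrA; apply: ler_wpM2l => //.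
rewrite -[leRHS]mul1r ler_pdivlMr ?mulr_gt0 ?exprn_gt0//.
rewrite mulrAC ler_pdivrMr ?mulr_gt0 ?exprn_gt0// mul1r mulrCA.
apply: ler_wpM2l; first exact: ltW (exprn_gt0 _ _).
have : 4 * (sk + 1) <= del * (sk + 1) * (sk + 1) by rewrite ler_wpM2r// ltW.
lra.
Qed.

(** The profile P/s + Q/s^2 is a supersolution: in one step 1/s and 1/s^2 lose at
    most 1/s^2 and 2/s^3, and the contraction beta/s exceeds these losses by
    (beta - 1) P/s^2 and (beta - 2) Q/s^3, which absorb the two forcing terms.
    The condition 2 < beta is what lets the second profile follow 1/s^2. *)
Lemma average_recursion (U : nat -> R) (beta c2 c3 u0 : R) :
  2 < beta -> beta <= K -> 0 <= c2 -> 0 <= c3 -> 0 <= u0 -> U 0%N <= u0 ->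
  (forall k, U k.+1 <= (1 - beta / s k) * U k + c2 / s k ^+ 2 + c3 / s k ^+ 3) ->
  forall k, U k <= c2 / (beta - 1) / s k + (c3 / (beta - 2) + u0 * K ^+ 2) / s k ^+ 2.
Proof.
move=> b2 bK c20 c30 u00 Uu rec.
set P := c2 / (beta - 1); set Q := c3 / (beta - 2) + _.
have P0 : 0 <= P by rewrite divr_ge0// subr_ge0; lra.
have c3Q0 : 0 <= c3 / (beta - 2) by rewrite divr_ge0// subr_ge0; lra.
have uK0 : 0 <= u0 * K ^+ 2 by rewrite mulr_ge0 ?sqr_ge0.
have Q0 : 0 <= Q by rewrite addr_ge0.
have eP : (beta - 1) * P = c2 by rewrite mulrC divfK// gt_eqF// subr_gt0; lra.
have eQ : c3 <= (beta - 2) * Q.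
  have e : (beta - 2) * (c3 / (beta - 2)) = c3.
    by rewrite mulrC divfK// gt_eqF// subr_gt0.
  by rewrite /Q mulrDr e lerDl mulr_ge0// subr_ge0 ltW.
elim=> [|k IH].
  rewrite add0r (le_trans Uu)//.
  have h : u0 <= Q / K ^+ 2 by rewrite ler_pdivlMr ?exprn_gt0// lerDr.
  by rewrite (le_trans h)// lerDr divr_ge0// ltW.
apply: (le_trans (rec k)).
have s0 := shift_gt0 k; rewrite shiftS.
have sK : beta <= s k by rewrite (le_trans bK)// lerDr.
set sk := s k in s0 sK IH *; pose t := sk^-1.
have t0 : 0 < t by rewrite invr_gt0.
have st : sk * t = 1 by rewrite /t mulfV// gt_eqF.
have s1 : 0 < sk + 1 by rewrite addr_gt0.
have h1 : t - t ^+ 2 <= (sk + 1)^-1.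
  rewrite -[leRHS]mul1r ler_pdivlMr//.
  rewrite (_ : _ * _ = sk * t - (sk * t) * t + t - t ^+ 2); last by ring.
  by rewrite st mul1r; have := sqr_ge0 t; lra.
have h2 : t ^+ 2 - 2 * t ^+ 3 <= (sk + 1)^-2.
  rewrite -[leRHS]mul1r ler_pdivlMr ?exprn_gt0//.
  rewrite (_ : _ * _ = (sk * t) ^+ 2 - 2 * (sk * t) ^+ 2 * t + 2 * (sk * t) * t
     - 4 * (sk * t) * t ^+ 2 + t ^+ 2 - 2 * t ^+ 3); last by ring.
  by rewrite st; have := sqr_ge0 t; have := exprn_gt0 3 t0; lra.
rewrite -![_ / sk ^+ _]/(_ * _) -!exprVn -/t in IH *.
have h3 : (1 - beta * t) * U k <= (1 - beta * t) * (P * t + Q * t ^+ 2).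
  by apply: ler_wpM2l => //; rewrite subr_ge0 ler_pdivrMr// mul1r.
have h4 := ler_wpM2l P0 h1; have h5 := ler_wpM2l Q0 h2.
have h6 : c3 * t ^+ 3 <= (beta - 2) * Q * t ^+ 3 by rewrite ler_pM2r ?exprn_gt0.
rewrite -eP; lra.
Qed.

End Recursions.

(** * The convergence rate *)
Ltac pos := first
  [ assumption | exact: ltr01 | exact: ler01 | exact: ltr0n | exact: ler0n
  | exact: sqr_ge0 | (apply: ltW; assumption)
  | (apply: addr_gt0; pos) | (apply: mulr_gt0; pos) | (rewrite invr_gt0; pos)
  | (apply: exprn_gt0; pos)
  | (apply: addr_ge0; pos) | (apply: mulr_ge0; pos) | (rewrite invr_ge0; pos)
  | (apply: exprn_ge0; pos) ].

Section Rate.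
Context {R : realType}.
Variables (theta mu L sigma M a b K : R).
Hypotheses (theta_gt2 : 2 < theta) (mu_gt0 : 0 < mu) (L_gt0 : 0 < L)
  (sigma_gt0 : 0 < sigma) (M_gt0 : 0 < M) (a_gt0 : 0 < a) (b_gt0 : 0 < b).
Hypotheses (K_gt0 : 0 < K) (K_large : 2 * theta * (1 + M) * L ^+ 2 / mu ^+ 2 <= K).

Local Notation s k := (k%:R + K).
Let al (k : nat) : R := theta / (mu * s k).
(* eps is chosen so that (1 - eps) theta = beta; both eps > 0 and beta > 2 hold
   exactly when theta > 2 *)
Let eps : R := 1 / 2 - 1 / theta.
Let beta : R := 1 + theta / 2.

Ltac slra := have := theta_gt2; have := M_gt0; have := mu_gt0; lra.

Let theta_gt0 : 0 < theta. Proof. by rewrite (lt_trans _ theta_gt2). Qed.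

Let eps_gt0 : 0 < eps.
Proof. by rewrite /eps !div1r subr_gt0 ltf_pV2 ?posrE. Qed.

Let al_gt0 k : 0 < al k.
Proof. by rewrite divr_gt0// mulr_gt0// shift_gt0. Qed.

(** The purpose of the lower bound on K: from the first step on, the step size
    is small enough for the strong convexity to absorb the multiplicative noise. *)
Lemma step_small k : al k * (2 * (1 + M) * L ^+ 2) <= mu.
Proof.
have s0 := shift_gt0 K_gt0 k.
rewrite /al mulrAC ler_pdivrMr ?mulr_gt0//.
have : mu ^+ 2 * (2 * theta * (1 + M) * L ^+ 2 / mu ^+ 2) <= mu ^+ 2 * s k.
  by rewrite ler_pM2l ?exprn_gt0// (le_trans K_large)// lerDr.
rewrite [X in X <= _]mulrC divfK ?gt_eqF ?exprn_gt0//.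
by rewrite expr2; slra.
Qed.

Let al_sqr k : al k ^+ 2 = (theta / mu) ^+ 2 / s k ^+ 2.
Proof. by rewrite /al; field; rewrite !gt_eqF ?shift_gt0. Qed.

(* Per agent: D bounds the mean squared error, B/((1 - rho) s^2) the dispersion
   created in one step, E/((1 - rho)^2 s^2) the accumulated dispersion, and
   c3/((1 - rho)^2 s^3) the effect of the latter on the barycentre. *)
Let cS : R := (2 / mu + mu / L ^+ 2) * b + mu / (2 * L ^+ 2) * sigma ^+ 2.
Let D : R := a + 2 * cS / mu.
Let B : R := (theta / mu) ^+ 2 *
  (2 * (1 + M) * (2 * L ^+ 2 * D + 2 * b) + 2 * sigma ^+ 2).
Let E : R := 16 * D + D * K ^+ 2 + 2 * B.
Let c3 : R := theta * (1 + L ^+ 2 / (eps * mu ^+ 2)) * E.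

Let cS_gt0 : 0 < cS.
Proof. by rewrite /cS; pos. Qed.

Let D_gt0 : 0 < D.
Proof. by rewrite /D; pos. Qed.

Let B_gt0 : 0 < B.
Proof. by rewrite /B; pos. Qed.

Let E_gt0 : 0 < E.
Proof. by rewrite /E; pos. Qed.

Let c3_gt0 : 0 < c3.
Proof. by rewrite /c3; pos. Qed.

(** N stands for the number of agents, gs for the sum of the squared gradients at
    the optimum; S, V, U and G for the expected total squared error, dispersion,
    squared error of the barycentre and total squared gradient. *)
Section Sequences.
Variables (N rho gs : R) (S V U G : nat -> R).
Hypotheses (N_ge1 : 1 <= N) (rho_ge0 : 0 <= rho) (rho_lt1 : rho < 1)
  (mu_L : mu <= L) (gs_ge0 : 0 <= gs) (gs_le : gs <= b * N) (S0 : S 0%N <= a * N).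
Hypotheses (V_ge0 : forall k, 0 <= V k) (U_ge0 : forall k, 0 <= U k)
  (S_split : forall k, S k = V k + N * U k)
  (G_le : forall k, G k <= 2 * L ^+ 2 * S k + 2 * gs).
Hypothesis S_step : forall k, S k.+1 <= (1 - al k * mu / 2) * S k
  + al k * (2 / mu + mu / L ^+ 2) * gs + al k ^+ 2 * (N * sigma ^+ 2).
Hypothesis V_step : forall k, V k.+1 <= rho * V k
  + al k ^+ 2 / (1 - rho) * (2 * (1 + M) * G k + 2 * (N * sigma ^+ 2)).
Hypothesis U_step : forall k e, 0 < e ->
  U k.+1 <= (1 - 2 * al k * mu + al k ^+ 2 * L ^+ 2 + e * al k * mu) * U k
  + (al k ^+ 2 + al k / (e * mu)) * (L ^+ 2 / N) * V k
  + al k ^+ 2 / N ^+ 2 * (N * sigma ^+ 2 + M * G k).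

Let N_gt0 : 0 < N. Proof. by rewrite (lt_le_trans _ N_ge1). Qed.

Let mu2_L2 : mu ^+ 2 <= L ^+ 2.
Proof. by rewrite ler_pXn2r// nnegrE; pos. Qed.

(** The constant does not involve rho, because S_step does not: mixing never
    increases the total squared error. *)
Lemma S_bounded k : S k <= D * N.
Proof.
have Nc : 0 < 2 * cS / mu by rewrite divr_gt0// mulr_gt0.
apply: (@bounded_recursion _ S (fun k => al k * mu / 2) (2 * cS / mu * N)).
- by move=> j; rewrite ltW// divr_gt0// mulr_gt0.
- move=> j; have h : al j * (2 * L ^+ 2) <= mu.
    apply: le_trans (step_small j); rewrite ler_wpM2l ?(ltW (al_gt0 j))//.
    by rewrite ler_wpM2r ?sqr_ge0//; slra.
  have m2 : al j * mu ^+ 2 <= al j * L ^+ 2.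
    by apply: ler_wpM2l; [exact: ltW (al_gt0 j)|exact: mu2_L2].
  have : mu * (al j * mu / 2) <= mu * 1 by rewrite expr2 in m2; slra.
  by rewrite ler_pM2l.
- by rewrite (le_trans S0)// ler_wpM2r ?(ltW N_gt0)// /D lerDl ltW.
- by rewrite ler_wpM2r ?(ltW N_gt0)// /D lerDr ltW.
move=> j; apply: (le_trans (S_step j)).
rewrite -addrA lerD2l.
have -> : al j * mu / 2 * (2 * cS / mu * N) = al j * (cS * N).
  by field; rewrite gt_eqF.
have h1 : al j * (2 / mu + mu / L ^+ 2) * gs
    <= al j * (2 / mu + mu / L ^+ 2) * (b * N).
  by rewrite ler_wpM2l// ltW// mulr_gt0// addr_gt0 ?divr_gt0 ?exprn_gt0.
have h2 : al j * (al j * (N * sigma ^+ 2)) <=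
    al j * (mu / (2 * L ^+ 2) * (N * sigma ^+ 2)).
  rewrite ler_wpM2l ?(ltW (al_gt0 j))// ler_wpM2r//.
    by rewrite mulr_ge0 ?sqr_ge0 ?ltW.
  rewrite ler_pdivlMr ?mulr_gt0 ?exprn_gt0//.
  apply: le_trans (step_small j); rewrite ler_wpM2l ?(ltW (al_gt0 j))//.
  by rewrite ler_wpM2r ?sqr_ge0//; slra.
by rewrite /cS; slra.
Qed.

Lemma V_decay k : V k <= E * N / ((1 - rho) ^+ 2 * s k ^+ 2).
Proof.
have d0 : 0 < 1 - rho by rewrite subr_gt0.
rewrite (_ : E * N = 16 * (D * N) + D * N * K ^+ 2 + 2 * (B * N)); last first.
  by rewrite /E; ring.
apply: (consensus_recursion K_gt0) => //.
- by rewrite ltW// mulr_gt0.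
- by rewrite ltW// mulr_gt0.
- move=> j; apply: le_trans (S_bounded j); rewrite S_split lerDl.
  by rewrite mulr_ge0// ltW.
move=> j; apply: (le_trans (V_step j)); rewrite lerD2l al_sqr.
have s0 := shift_gt0 K_gt0 j.
rewrite (_ : B * N / _ = (theta / mu) ^+ 2 / s j ^+ 2 / (1 - rho) *
  (2 * (1 + M) * (2 * L ^+ 2 * (D * N) + 2 * (b * N)) + 2 * (N * sigma ^+ 2)));
  last by rewrite /B; field; rewrite !gt_eqF.
apply: ler_wpM2l; first by rewrite !divr_ge0 ?sqr_ge0 ?divr_ge0 ?ltW.
rewrite lerD2r; apply: ler_wpM2l; first by rewrite mulr_ge0// addr_ge0// ltW.
apply: (le_trans (G_le j)); apply: lerD; last by rewrite ler_wpM2l.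
by rewrite ler_wpM2l ?S_bounded// mulr_ge0 ?sqr_ge0.
Qed.

Lemma U_decay k : U k <=
  (theta / mu) ^+ 2 * (2 * M * gs / N + sigma ^+ 2) / N / (beta - 1) / s k
  + (c3 / (1 - rho) ^+ 2 / (beta - 2) + a * K ^+ 2) / s k ^+ 2.
Proof.
have d0 : 0 < 1 - rho by rewrite subr_gt0.
set Mb := 2 * M * gs / N + sigma ^+ 2.
have Mb0 : 0 <= Mb.
  by rewrite /Mb; pos.
apply: (average_recursion K_gt0).
- by rewrite /beta; slra.
- apply: le_trans K_large; rewrite ler_pdivlMr ?exprn_gt0//.
  apply: (@le_trans _ _ (2 * theta * mu ^+ 2)).
    by rewrite ler_wpM2r ?sqr_ge0// /beta; slra.
  rewrite -[leRHS]mulrA ler_wpM2l ?mulr_ge0 ?(ltW theta_gt0)//.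
  apply: (@le_trans _ _ (L ^+ 2)); first exact: mu2_L2.
  by rewrite ler_peMl ?sqr_ge0//; slra.
- by pos.
- by pos.
- by pos.
- have : N * U 0%N <= N * a by have := V_ge0 0%N; have := S_split 0%N; have := S0; slra.
  by rewrite ler_pM2l.
move=> j; apply: (le_trans (U_step j eps_gt0)).
have s0 := shift_gt0 K_gt0 j; have a0 := al_gt0 j; have as_ := step_small j.
have Ni : N^-1 <= 1 by rewrite invf_le1.
have Ni0 : 0 < N^-1 by rewrite invr_gt0.
(* splits off the leading variance, divided by N by averaging *)
have noise : al j ^+ 2 / N ^+ 2 * (N * sigma ^+ 2 + M * G j) <=
    al j ^+ 2 * Mb / N + al j ^+ 2 * (2 * M * L ^+ 2) / N ^+ 2 * V j
      + al j ^+ 2 * (2 * M * L ^+ 2) / N * U j.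
  have h : M * G j <= M * (2 * L ^+ 2 * (V j + N * U j) + 2 * gs).
    by rewrite ler_wpM2l ?(ltW M_gt0)// -S_split.
  apply: (@le_trans _ _ (al j ^+ 2 / N ^+ 2 *
      (N * sigma ^+ 2 + M * (2 * L ^+ 2 * (V j + N * U j) + 2 * gs)))).
    by rewrite ler_wpM2l ?lerD2l//; pos.
  rewrite le_eqVlt; apply/orP; left; apply/eqP.
  by rewrite /Mb; field; rewrite gt_eqF.
have coefU : 1 - 2 * al j * mu + al j ^+ 2 * L ^+ 2 + eps * al j * mu
    + al j ^+ 2 * (2 * M * L ^+ 2) / N <= 1 - beta / s j.
  have -> : beta / s j = al j * mu * (1 - eps).
    by rewrite /beta /al /eps; field; rewrite !gt_eqF.
  have h1 : al j ^+ 2 * (2 * M * L ^+ 2) / N <= al j ^+ 2 * (2 * M * L ^+ 2).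
    by rewrite ler_piMr//; pos.
  have h2 := ler_wpM2l (ltW a0) as_.
  have h3 : 0 <= al j * (al j * L ^+ 2) by pos.
  slra.
have coefV : (al j ^+ 2 + al j / (eps * mu)) * (L ^+ 2 / N) +
    al j ^+ 2 * (2 * M * L ^+ 2) / N ^+ 2 <= al j / N * (mu + L ^+ 2 / (eps * mu)).
  rewrite (_ : _ + _ = al j / N * (al j * L ^+ 2 + al j * (2 * M * L ^+ 2) * N^-1
      + L ^+ 2 / (eps * mu))); last by field; rewrite !gt_eqF.
  apply: ler_wpM2l; first by pos.
  rewrite lerD2r.
  have h1 : al j * (2 * M * L ^+ 2) * N^-1 <= al j * (2 * M * L ^+ 2).
    by rewrite ler_piMr//; pos.
  have h3 : 0 <= al j * L ^+ 2 by pos.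
  slra.
have hU := ler_wpM2r (U_ge0 j) coefU; have hV := ler_wpM2r (V_ge0 j) coefV.
have hV2 : al j / N * (mu + L ^+ 2 / (eps * mu)) * V j <=
    c3 / (1 - rho) ^+ 2 / s j ^+ 3.
  apply: (@le_trans _ _ (al j / N * (mu + L ^+ 2 / (eps * mu)) *
     (E * N / ((1 - rho) ^+ 2 * s j ^+ 2)))).
    by rewrite ler_wpM2l ?V_decay//; pos.
  rewrite le_eqVlt; apply/orP; left; apply/eqP.
  by rewrite /c3 /al; field; rewrite !gt_eqF.
have eN : al j ^+ 2 * Mb / N = (theta / mu) ^+ 2 * Mb / N / s j ^+ 2.
  by rewrite al_sqr; field; rewrite !gt_eqF.
rewrite -eN; slra.
Qed.

Let Q : R := c3 / (beta - 2) + a * K ^+ 2 + E.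

(** The dispersion, the response of the barycentre to it and the initial condition
    are all O(1/((1 - rho)^2 k^2)), which is O(1/(N k)) from k = N/(1 - rho)^2 on;
    they are then comparable to the leading term because the noise level
    2 M gs/N + sigma^2 is at least sigma^2. *)
Lemma dsgd_rate k : N / (1 - rho) ^+ 2 <= k%:R ->
  N^-1 * S k <= (2 * theta - 1) * (1 / (beta - 1) + Q * mu ^+ 2 / (sigma ^+ 2 * theta ^+ 2))
    * (theta ^+ 2 * (2 * M * gs / N + sigma ^+ 2)
        / ((2 * theta - 1) * N * mu ^+ 2 * k%:R)).
Proof.
have d0 : 0 < 1 - rho by rewrite subr_gt0.
have d1 : (1 - rho) ^+ 2 <= 1 by rewrite exprn_ile1 ?(ltW d0)//; have := rho_ge0; slra.
have d20 : 0 < (1 - rho) ^+ 2 by rewrite exprn_gt0.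
move=> Nk; have k0 : 0 < k%:R :> R by rewrite (lt_le_trans _ Nk)// divr_gt0.
have s0 := shift_gt0 K_gt0 k.
have b2 : 0 < beta - 2 by rewrite /beta; slra.
have b1 : 0 < beta - 1 by rewrite /beta; slra.
set Mb := 2 * M * gs / N + sigma ^+ 2.
have sMb : sigma ^+ 2 <= Mb.
  by rewrite lerDr; pos.
have Mb0 : 0 <= Mb by rewrite (le_trans _ sMb)// sqr_ge0.
have sk : k%:R <= s k by rewrite lerDl ltW.
have ks : (s k)^-1 <= k%:R^-1 by rewrite lef_pV2 ?posrE.
have ks2 : (s k ^+ 2)^-1 <= (k%:R ^+ 2)^-1.
  by rewrite lef_pV2 ?posrE ?exprn_gt0// ler_pXn2r// nnegrE; pos.
have Nk2 : ((1 - rho) ^+ 2)^-1 / k%:R ^+ 2 <= (N * k%:R)^-1.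
  rewrite (_ : _ / _ = N / (1 - rho) ^+ 2 / k%:R * (N * k%:R)^-1); last first.
    by field; rewrite !gt_eqF.
  rewrite -[leRHS]mul1r; apply: ler_wpM2r; first by pos.
  by rewrite ler_pdivrMr// mul1r.
have c30 := ltW c3_gt0; have E0 := ltW E_gt0.
have Q0 : 0 <= Q.
  by rewrite /Q; pos.
(* all but the leading variance term is O(1/((1 - rho) k)^2) *)
have tail : (c3 / (1 - rho) ^+ 2 / (beta - 2) + a * K ^+ 2) / s k ^+ 2
    + N^-1 * V k <= Q * (N * k%:R)^-1.
  have hV : N^-1 * V k <= E / (1 - rho) ^+ 2 / s k ^+ 2.
    rewrite ler_pdivrMl// (le_trans (V_decay k))// le_eqVlt; apply/orP; left.
    by apply/eqP; field; rewrite !gt_eqF.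
  have ha : a * K ^+ 2 <= a * K ^+ 2 / (1 - rho) ^+ 2.
    by rewrite ler_peMr ?invf_ge1//; pos.
  have si0 : 0 <= (s k ^+ 2)^-1 by rewrite invr_ge0 sqr_ge0.
  have ha2 := ler_wpM2r si0 ha.
  apply: (@le_trans _ _ (Q * (((1 - rho) ^+ 2)^-1 / s k ^+ 2))).
    by rewrite /Q; slra.
  apply: ler_wpM2l => //; apply: le_trans Nk2.
  by apply: ler_wpM2l => //; pos.
have lead : (theta / mu) ^+ 2 * Mb / N / (beta - 1) / s k <=
    (theta / mu) ^+ 2 * Mb / N / (beta - 1) / k%:R.
  by apply: ler_wpM2l => //; pos.
have QM : Q * (N * k%:R)^-1 <= Q * (N * k%:R)^-1 * (Mb / sigma ^+ 2).
  rewrite ler_peMr//; first by pos.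
  by rewrite ler_pdivlMr ?mul1r ?exprn_gt0.
have t1 : 0 < 2 * theta - 1 by slra.
rewrite (_ : _ * (theta ^+ 2 * _ / _) = (theta / mu) ^+ 2 * Mb / N / (beta - 1) / k%:R
   + Q * (N * k%:R)^-1 * (Mb / sigma ^+ 2)); last first.
  by field; rewrite !gt_eqF.
rewrite S_split mulrDr mulKf ?gt_eqF//.
have := U_decay k; rewrite -/Mb; slra.
Qed.

End Sequences.

Definition rate_cst : R := (2 * theta - 1) * (1 / (beta - 1) +
  (c3 / (beta - 2) + a * K ^+ 2 + E) * mu ^+ 2 / (sigma ^+ 2 * theta ^+ 2)).

Lemma rate_cst_gt0 : 0 < rate_cst.
Proof.
have b2 : 0 < beta - 2 by rewrite /beta; slra.
have b1 : 0 < beta - 1 by rewrite /beta; slra.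
have t1 : 0 < 2 * theta - 1 by slra.
by rewrite /rate_cst; pos.
Qed.

End Rate.

(** * Square-integrable random vectors *)
Section SquareIntegrable.
Context d (T : measurableType d) (R : realType) (P : probability T R).
Implicit Types X Y : T -> R.

Definition sqint X := measurable_fun setT X /\
  P.-integrable setT (EFin \o (fun w => X w ^+ 2)).

Lemma integrableDr X Y : P.-integrable setT (EFin \o X) ->
  P.-integrable setT (EFin \o Y) -> P.-integrable setT (EFin \o (fun w => X w + Y w)).
Proof. by move=> iX iY; exact: (integrableD measurableT iX iY). Qed.

Lemma integrableZr (c : R) X : P.-integrable setT (EFin \o X) ->
  P.-integrable setT (EFin \o (fun w => c * X w)).
Proof. by move=> iX; exact: (integrableZl measurableT c iX). Qed.

Lemma integrable_sumr n (X : 'I_n -> T -> R) :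
  (forall i, P.-integrable setT (EFin \o X i)) ->
  P.-integrable setT (EFin \o (fun w => \sum_i X i w)).
Proof.
move=> iX; rewrite (_ : _ \o _ = fun w => (\sum_i (X i w)%:E)%E).
  by apply: integrable_sum => // i _; exact: iX.
by apply/funext => w /=; rewrite sumEFin.
Qed.

Lemma Rintegral_sumr n (X : 'I_n -> T -> R) :
  (forall i, P.-integrable setT (EFin \o X i)) ->
  \int[P]_w (\sum_i X i w) = \sum_i \int[P]_w X i w.
Proof.
elim: n X => [|n IH] X iX.
  by under eq_Rintegral do rewrite big_ord0; rewrite Rintegral_cst// mul0r big_ord0.
under eq_Rintegral do rewrite big_ord_recl.
rewrite RintegralD//=; last by apply: integrable_sumr => i; exact: iX.
by rewrite IH ?big_ord_recl// => i; exact: iX.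
Qed.

Lemma Rintegral_cst1 (c : R) : \int[P]_w c = c.
Proof.
have PT : fine (P setT) = 1 by rewrite (probability_setT P).
by rewrite Rintegral_cst// PT mulr1.
Qed.

Lemma sqint_mul X Y : sqint X -> sqint Y ->
  P.-integrable setT (EFin \o (fun w => X w * Y w)).
Proof.
move=> [mX iX] [mY iY]; apply: (integrable_dom _ (integrableDr iX iY)).
  exact: measurable_funM.
by move=> w; rewrite ler_norml; have := sqr_ge0 (X w + Y w);
  have := sqr_ge0 (X w - Y w); nra.
Qed.

Lemma sqint_cst (c : R) : sqint (fun=> c).
Proof. by split; [exact: measurable_cst|exact: integrable_cstr]. Qed.

Lemma sqintD X Y : sqint X -> sqint Y -> sqint (fun w => X w + Y w).
Proof.
move=> sX sY; split; first by apply: measurable_funD; [exact: sX.1|exact: sY.1].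
under eq_fun do rewrite sqrrD.
apply: integrableDr; last exact: sY.2.
apply: integrableDr; first exact: sX.2.
by under eq_fun do rewrite -mulr_natl; apply: integrableZr; exact: sqint_mul.
Qed.

Lemma sqintZ (c : R) X : sqint X -> sqint (fun w => c * X w).
Proof.
move=> [mX iX]; split; first exact: measurable_funM.
by under eq_fun do rewrite exprMn; exact: integrableZr.
Qed.

Lemma sqint_integrable X : sqint X -> P.-integrable setT (EFin \o X).
Proof.
move=> /(sqint_mul (sqint_cst 1)); congr (P.-integrable _ _).
by apply/funext => w /=; rewrite mul1r.
Qed.

Section Vectors.
Context {p : nat}.
Implicit Types u v : T -> 'cV[R]_p.

Definition vsqint u := forall j, sqint (fun w => u w j 0).

Lemma vsqint_cst (c : 'cV[R]_p) : vsqint (fun=> c).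
Proof. by move=> j; exact: sqint_cst. Qed.

Lemma vsqintD u v : vsqint u -> vsqint v -> vsqint (fun w => u w + v w).
Proof.
by move=> su sv j; under eq_fun do rewrite mxE; apply: sqintD; [exact: su|exact: sv].
Qed.

Lemma vsqintZ (c : R) u : vsqint u -> vsqint (fun w => c *: u w).
Proof. by move=> su j; under eq_fun do rewrite mxE; exact/sqintZ/su. Qed.

Lemma vsqintB u v : vsqint u -> vsqint v -> vsqint (fun w => u w - v w).
Proof.
move=> su sv; apply: vsqintD => //.
by under eq_fun do rewrite -scaleN1r; exact: vsqintZ.
Qed.

Lemma vsqint_sum n (u : 'I_n -> T -> 'cV[R]_p) :
  (forall i, vsqint (u i)) -> vsqint (fun w => \sum_i u i w).
Proof.
elim: n u => [|n IH] u su.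
  by under eq_fun do rewrite big_ord0; exact: vsqint_cst.
under eq_fun do rewrite big_ord_recl.
by apply: vsqintD => //; apply: IH => i.
Qed.

Lemma vsqint_avg n (u : 'I_n -> T -> 'cV[R]_p) :
  (forall i, vsqint (u i)) -> vsqint (fun w => avg (fun i => u i w)).
Proof. by move=> su; apply: vsqintZ; exact: vsqint_sum. Qed.

Lemma integrable_dotv u v : vsqint u -> vsqint v ->
  P.-integrable setT (EFin \o (fun w => dotv (u w) (v w))).
Proof. by move=> su sv; apply: integrable_sumr => j; exact: sqint_mul. Qed.

Lemma Rintegral_dotv_eq0 u v : vsqint u -> vsqint v ->
  (forall j, (\int[P]_w (v w j 0 * u w j 0)%:E = 0)%E) ->
  \int[P]_w dotv (u w) (v w) = 0.
Proof.
move=> su sv uv0; rewrite Rintegral_sumr => [|j]; last exact: sqint_mul.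
rewrite big1// => j _; rewrite /Rintegral; under eq_integral do rewrite mulrC.
by rewrite uv0.
Qed.

(** Pythagoras: an orthogonal noise adds its variance. *)
Lemma Rintegral_sqr_orthogonal u v (c : R) : vsqint u -> vsqint v ->
  \int[P]_w dotv (u w) (v w) = 0 ->
  \int[P]_w dotv (u w - c *: v w) (u w - c *: v w) =
  \int[P]_w dotv (u w) (u w) + c ^+ 2 * \int[P]_w dotv (v w) (v w).
Proof.
move=> su sv uv0.
have iuu := integrable_dotv su su; have iuv := integrable_dotv su sv.
have ivv := integrable_dotv sv sv.
have e w : dotv (u w - c *: v w) (u w - c *: v w) = dotv (u w) (u w) +
    ((- (2 * c)) * dotv (u w) (v w) + c ^+ 2 * dotv (v w) (v w)).
  by rewrite dotv_sqrB !(dotvZl, dotvZr); ring.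
under eq_Rintegral do rewrite e.
rewrite RintegralD//; last by apply: integrableDr; exact: integrableZr.
rewrite RintegralD//; [|exact: integrableZr|exact: integrableZr].
by rewrite !RintegralZl// uv0 mulr0 add0r.
Qed.

End Vectors.

End SquareIntegrable.

Section BorelVec.
Context (R : realType) (p : nat).

Lemma measurable_coord (j : 'I_p) :
  measurable_fun setT (fun v : borel_vec R p => v j 0).
Proof.
move=> _ B mB; apply: sub_sigma_algebra; exists j => //.
by exists B.
Qed.

Lemma measurable_fun_vec d (T : measurableType d) (u : T -> 'cV[R]_p) :
  (forall j, measurable_fun setT (fun w => u w j 0)) ->
  measurable_fun setT (u : T -> borel_vec R p).
Proof.
move=> mu; apply: (@measurability _ _ _ (borel_vec R p) _ _ (\bigcup_(j in [set: 'I_p])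
    preimage_set_system setT (fun v : 'cV[R]_p => v j 0) measurable)) => //.
move=> _ [_ [j _ [B mB <-]] <-].
have := mu j measurableT _ mB; rewrite setTI; congr (measurable _).
by rewrite !setTI.
Qed.

End BorelVec.

(** * The gradient noise along the iterates *)
Lemma coord_sqr_le (R : realType) (p : nat) (u : 'cV[R]_p) j :
  u j 0 ^+ 2 <= dotv u u.
Proof.
rewrite /dotv (bigD1 j)//= expr2 lerDl sumr_ge0// => l _.
by rewrite -expr2 sqr_ge0.
Qed.

(** Young's inequality for the cross term with weight 1 - rho, so that |u|^2 gets
    the coefficient rho^2 + rho (1 - rho) = rho; no division by rho, which may
    vanish, occurs. *)
Lemma rho_young (R : realType) (p : nat) (u v : 'cV[R]_p) (rho c : R) :
  0 <= rho -> rho < 1 ->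
  rho ^+ 2 * dotv (u - c *: v) (u - c *: v) <=
  rho * dotv u u + c ^+ 2 / (1 - rho) * dotv v v.
Proof.
move=> r0 r1; have d0 : 0 < 1 - rho by rewrite subr_gt0.
have y := ler_wpM2l r0 (dotv_young u (- (rho * c) *: v) d0).
rewrite !(dotvZl, dotvZr) in y.
rewrite dotv_sqrB !(dotvZl, dotvZr).
have e : rho ^+ 2 * (c ^+ 2 * dotv v v) +
    rho * ((1 - rho)^-1 * (rho * c * (rho * c) * dotv v v)) =
    rho ^+ 2 * (c ^+ 2 / (1 - rho) * dotv v v).
  by field; rewrite gt_eqF.
have h : rho ^+ 2 * (c ^+ 2 / (1 - rho) * dotv v v) <= c ^+ 2 / (1 - rho) * dotv v v.
  rewrite ler_piMl//; last by rewrite exprn_ile1// ltW.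
  by apply: mulr_ge0; [pos|exact: dotv_ge0].
lra.
Qed.

Section Oracle.
Context {R : realType} {n p m : nat} {T : Type}.
Variables (f : 'I_n -> 'cV[R]_p -> R) (g : 'I_n -> 'cV[R]_p -> 'cV[R]_m -> 'cV[R]_p)
  (x : 'I_n -> nat -> T -> 'cV[R]_p) (xi : 'I_n -> nat -> T -> 'cV[R]_m).

Definition sgradient i k w := g i (x i k w) (xi i k w).
Definition fgradient i k w := grad (f i) (x i k w).
Definition gnoise i k w := sgradient i k w - fgradient i k w.

Lemma sgradient_split i k w : sgradient i k w = fgradient i k w + gnoise i k w.
Proof. by rewrite /gnoise addrC subrK. Qed.

Lemma gnoiseE i k w j :
  gnoise i k w j 0 = sgradient i k w j 0 - fgradient i k w j 0.
Proof.
by rewrite /gnoise; move: (sgradient _ _ _) (fgradient _ _ _) => u v; rewrite !mxE.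
Qed.

End Oracle.

(** Vectors known given the history; encoded as measurability from the space
    carrying the sigma-algebra of the history, to inherit closure properties. *)
Definition adapted (R : realType) (n p : nat) (T : pointedType)
    (x : 'I_n -> nat -> T -> 'cV[R]_p) k (u : T -> 'cV[R]_p) := forall j,
  measurable_fun setT ((fun w => u w j 0) : g_sigma_algebraType (history x k) -> R).

Section DSGD.
Context {R : realType} {n p m : nat} {mu L sigma M : R}
  {f : 'I_n -> 'cV[R]_p -> R} {e : rel 'I_n} {W : 'M[R]_n}
  {d : measure_display} {T : measurableType d} {P : probability T R}
  {g : 'I_n -> 'cV[R]_p -> 'cV[R]_m -> 'cV[R]_p} {x0 : 'I_n -> 'cV[R]_p}
  {xi : 'I_n -> nat -> T -> 'cV[R]_m} {alpha : nat -> R}.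
Local Notation x := (dsgd W alpha g x0 xi).
Hypotheses (n_gt0 : (0 < n)%N) (mu_gt0 : 0 < mu) (L_gt0 : 0 < L) (M_gt0 : 0 < M).
Hypothesis ssc : forall i, smooth_strongly_convex mu L (f i).
Hypothesis mW : mixing_matrix e W.
Hypothesis GN : gradient_noise P f g x xi sigma M.

Local Notation sgrad := (sgradient g x xi).
Local Notation fgrad := (fgradient f x).
Local Notation noise := (gnoise f g x xi).

Lemma noise_vsqint i k : vsqint P (noise i k).
Proof.
move=> j; have [V [[iV _ _ _] _]] := gn_variance GN i k.
have [ig idf _ _] := gn_unbiased GN i k j.
have mh : measurable_fun setT (fun w => noise i k w j 0).
  under eq_fun do rewrite gnoiseE.
  apply: measurable_funB.
    exact: integrable_measurable ig.
  exact: integrable_measurable idf.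
split=> //; apply: (integrable_dom _ iV); first exact: measurable_funX.
by move=> w; rewrite ger0_norm ?sqr_ge0// enorm_sqr coord_sqr_le.
Qed.

Lemma fgrad_vsqint i k : vsqint P (x i k) -> vsqint P (fgrad i k).
Proof.
move=> sx j; have [_ idf _ _] := gn_unbiased GN i k j.
have mdf := integrable_measurable idf.
have ix := integrable_dotv sx sx.
have ib := integrableDr (integrableZr (2 * L ^+ 2) ix)
  (integrable_cstr P (2 * dotv (grad (f i) 0) (grad (f i) 0))).
split=> //; apply: (integrable_dom _ ib); first exact: measurable_funX.
move=> w; rewrite ger0_norm ?sqr_ge0// (le_trans (coord_sqr_le _ _))//.
by have := grad_sqr_le ssc L_gt0 i (x i k w) 0; rewrite subr0.
Qed.

(** Finite second moments propagate along the iteration: the gradient grows at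
    most linearly and the noise has an integrable square by hypothesis. *)
Lemma iterate_vsqint k i : vsqint P (x i k).
Proof.
elim: k i => [|k IH] i; first exact: vsqint_cst.
apply: vsqint_sum => j; apply: vsqintZ; apply: vsqintB; first exact: IH.
apply: vsqintZ; under eq_fun do rewrite -/(sgrad j k _) (sgradient_split f).
by apply: vsqintD; [apply: fgrad_vsqint|exact: noise_vsqint].
Qed.

Lemma fgradv i k : vsqint P (fgrad i k).
Proof. exact/fgrad_vsqint/iterate_vsqint. Qed.

Lemma sgradv i k : vsqint P (sgrad i k).
Proof.
rewrite (_ : sgrad i k = fun w => fgrad i k w + noise i k w).
  by apply: vsqintD; [exact: fgradv|exact: noise_vsqint].
by apply/funext => w; exact: sgradient_split.
Qed.

Local Notation H k := (history x k).

Lemma history_sigma k : sigma_algebra setT (H k).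
Proof. exact: smallest_sigma_algebra. Qed.

Lemma history_setT k : H k setT.
Proof. by have [H0 HC _] := history_sigma k; rewrite -(setD0 setT); exact: HC. Qed.

Lemma history_sub k : H k `<=` measurable.
Proof.
apply: smallest_sub; first exact: sigma_algebra_measurable.
move=> _ [i _ [t _ [B mB <-]]].
apply: (measurable_fun_vec (u := x i t)) => // j.
exact: (iterate_vsqint t i j).1.
Qed.

Lemma iterate_history i k (B : set (borel_vec R p)) :
  measurable B -> H k (x i k @^-1` B).
Proof.
move=> mB; apply: sub_sigma_algebra; exists i => //; exists k => //=.
by exists B => //; rewrite setTI.
Qed.

Lemma adapted_iterate i k : adapted x k (x i k).
Proof.
move=> j; apply: adapted_measurable => B mB.
have := measurable_coord j measurableT mB; rewrite setTI => mB'.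
exact: iterate_history mB'.
Qed.

Lemma adapted_fgrad i k : adapted x k (fgrad i k).
Proof.
by move=> j; apply: adapted_measurable; exact: ce_adapted (gn_unbiased GN i k j).
Qed.

Lemma adaptedD k u v : adapted x k u -> adapted x k v -> adapted x k (fun w => u w + v w).
Proof.
by move=> au av j; under eq_fun do rewrite mxE; exact: measurable_funD.
Qed.

Lemma adaptedZ k (c : R) u : adapted x k u -> adapted x k (fun w => c *: u w).
Proof.
by move=> au j; under eq_fun do rewrite mxE; exact: measurable_funM.
Qed.

Lemma adapted_cst k c : adapted x k (fun=> c).
Proof. by move=> j; exact: measurable_cst. Qed.

Lemma adaptedB k u v : adapted x k u -> adapted x k v -> adapted x k (fun w => u w - v w).
Proof.
move=> au av; apply: adaptedD => //.
by under eq_fun do rewrite -scaleN1r; exact: adaptedZ.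
Qed.

Lemma adapted_avg k (u : 'I_n -> T -> 'cV[R]_p) :
  (forall i, adapted x k (u i)) -> adapted x k (fun w => avg (fun i => u i w)).
Proof.
move=> au; apply: adaptedZ => j; under eq_fun do rewrite summxE.
by apply: (@measurable_sum _ (g_sigma_algebraType (H k))) => i; exact: au.
Qed.

Lemma noise_centered i k j A : H k A ->
  (\int[P]_(w in A) (noise i k w j 0)%:E = 0)%E.
Proof.
move=> HA; rewrite -[RHS](cond_exp_diff_eq0 (@history_sub k) (gn_unbiased GN i k j) HA).
by apply: eq_integral => w _; rewrite gnoiseE.
Qed.

(** Unbiasedness makes every coordinate of the noise integrate to zero over the
    events of the history, which is the setting of the pull-out property. *)
Lemma noise_orthogonal_adapted i k u : vsqint P u -> adapted x k u ->
  \int[P]_w dotv (u w) (noise i k w) = 0.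
Proof.
move=> su au; apply: Rintegral_dotv_eq0 => //; first exact: noise_vsqint.
move=> j; apply: (integral_mul_eq0 (history_sigma k) (@history_sub k)).
- exact: sqint_integrable (noise_vsqint i k j).
- by move=> A HA; exact: noise_centered.
- exact: measurable_adapted (history_sigma k) (au j).
- exact: sqint_mul (noise_vsqint i k j) (su j).
Qed.

(** By the joint measurability of g_i, the noise of agent i is a function of the
    history and of xi_i(k) only, so that conditional independence applies. *)
Lemma noise_orthogonal i j k : i != j ->
  \int[P]_w dotv (noise i k w) (noise j k w) = 0.
Proof.
move=> ij; apply: Rintegral_dotv_eq0; [exact: noise_vsqint|exact: noise_vsqint|].
move=> c; pose S l := rect_system (H k) (xi l k : T -> borel_vec R m).
have mz l := gn_measurable_xi GN l k.
have HS l : H k `<=` <<s S l >>.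
  by move=> A HA; apply: sub_sigma_algebra; exact: rect_system_sub.
have aN l B : measurable B -> <<s S l >> ((fun w => noise l k w c 0) @^-1` B).
  have mxl : measurable_fun setT (x l k : g_sigma_algebraType (S l) -> borel_vec R p).
    by move=> _ C mC; rewrite setTI; apply: HS; exact: iterate_history.
  have mxil : measurable_fun setT
      (xi l k : g_sigma_algebraType (S l) -> borel_vec R m).
    move=> _ C mC; rewrite setTI; apply: sub_sigma_algebra.
    exists setT; first exact: history_setT.
    by exists C => //; rewrite setTI.
  have mg : measurable_fun setT
      ((fun w => sgrad l k w c 0) : g_sigma_algebraType (S l) -> R).
    have mpair := measurable_fun_pair mxl mxil.
    have mgl := measurableT_comp (gn_measurable_g GN l) mpair.
    exact: (measurableT_comp (@measurable_coord R p c) mgl).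
  have mdf : measurable_fun setT
      ((fun w => fgrad l k w c 0) : g_sigma_algebraType (S l) -> R).
    move=> _ C mC; rewrite setTI; apply: HS.
    exact: (ce_adapted (gn_unbiased GN l k c)).
  have mn : measurable_fun setT
      ((fun w => noise l k w c 0) : g_sigma_algebraType (S l) -> R).
    by under eq_fun do rewrite gnoiseE; exact: measurable_funB.
  by move=> mB; have := mn measurableT _ mB; rewrite setTI.
apply: (cond_indep_uncorrelated (history_sigma k) (@history_sub k) mz
  (gn_independent GN k) ij).
- exact: aN.
- exact: aN.
- exact: sqint_integrable (noise_vsqint j k c).
- by move=> A HA; exact: noise_centered.
- exact: sqint_mul (noise_vsqint j k c) (noise_vsqint i k c).
Qed.

Lemma noise_variance i k : \int[P]_w dotv (noise i k w) (noise i k w) <=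
  sigma ^+ 2 + M * \int[P]_w dotv (fgrad i k w) (fgrad i k w).
Proof.
have [V [[iN iV _ eV] leV]] := gn_variance GN i k.
have igg := integrable_dotv (fgradv i k) (fgradv i k).
pose bnd w := sigma ^+ 2 + M * dotv (fgrad i k w) (fgrad i k w).
have ibnd : P.-integrable setT (EFin \o bnd).
  by apply: integrableDr; [exact: integrable_cstr|exact: integrableZr].
have mV := integrable_measurable iV; have mb := integrable_measurable ibnd.
pose V' w := Num.min (V w) (bnd w).
have VV' : {ae P, forall w, V w = V' w}.
  by apply: filterS leV => w; rewrite enorm_sqr => h; rewrite /V' min_l.
have iV' : P.-integrable setT (EFin \o V').
  apply: (integrable_dom (Y := fun w => `|V w| + `|bnd w|)).
  - exact: measurable_minr.
  - by apply: integrableDr; exact: integrable_norm.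
  - move=> w; rewrite /V' /Num.min; case: ifP => _.
      by rewrite lerDl.
    by rewrite lerDr.
have e1 : \int[P]_w dotv (noise i k w) (noise i k w) = \int[P]_w V' w.
  rewrite /Rintegral; congr fine.
  under eq_integral do rewrite -enorm_sqr.
  rewrite -eV; last exact: history_setT.
  apply: ae_eq_integral => //.
  - exact/measurable_EFinP.
  - by apply/measurable_EFinP; exact: integrable_measurable iV'.
  - by apply: filterS VV' => w -> _.
rewrite e1 (@le_trans _ _ (\int[P]_w bnd w))//.
  by apply: le_Rintegral => // w _; rewrite /V' ge_min lexx orbT.
rewrite /bnd RintegralD//; [|exact: integrable_cstr|exact: integrableZr].
by rewrite Rintegral_cst1 RintegralZl.
Qed.

End DSGD.

(** * Recursions for error, dispersion and barycentre *)
Section Energies.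
Context {R : realType} {n p : nat} {d : measure_display} {T : measurableType d}.
Variables (P : probability T R) (f : 'I_n -> 'cV[R]_p -> R)
  (x : 'I_n -> nat -> T -> 'cV[R]_p) (xs : 'cV[R]_p).

Definition barycentre k w := avg (fun j => x j k w).
Definition error k := \sum_i \int[P]_w dotv (x i k w - xs) (x i k w - xs).
Definition dispersion k := \sum_i \int[P]_w
  dotv (x i k w - barycentre k w) (x i k w - barycentre k w).
Definition bary_error k := \int[P]_w dotv (barycentre k w - xs) (barycentre k w - xs).
Definition grad_energy k := \sum_i \int[P]_w
  dotv (fgradient f x i k w) (fgradient f x i k w).

End Energies.

Section Recursion.
Context {R : realType} {n p m : nat} {mu L sigma M : R}
  {f : 'I_n -> 'cV[R]_p -> R} {e : rel 'I_n} {W : 'M[R]_n}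
  {d : measure_display} {T : measurableType d} {P : probability T R}
  {g : 'I_n -> 'cV[R]_p -> 'cV[R]_m -> 'cV[R]_p} {x0 : 'I_n -> 'cV[R]_p}
  {xi : 'I_n -> nat -> T -> 'cV[R]_m} {alpha : nat -> R} {xs : 'cV[R]_p}.
Local Notation x := (dsgd W alpha g x0 xi).
Hypotheses (n_gt0 : (0 < n)%N) (mu_gt0 : 0 < mu) (L_gt0 : 0 < L) (M_gt0 : 0 < M).
Hypothesis ssc : forall i, smooth_strongly_convex mu L (f i).
Hypothesis mW : mixing_matrix e W.
Hypothesis GN : gradient_noise P f g x xi sigma M.
Hypothesis alpha_gt0 : forall k, 0 < alpha k.

Local Notation sgr := (sgradient g x xi).
Local Notation fgr := (fgradient f x).
Local Notation nz := (gnoise f g x xi).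
Local Notation adp := (adapted x).
Local Notation xbar := (barycentre x).
Local Notation err := (error P x xs).
Local Notation disp := (dispersion P x).
Local Notation bary := (bary_error P x xs).
Local Notation gsq := (grad_energy P f x).

Let xv k i : vsqint P (x i k). Proof. exact: (iterate_vsqint L_gt0 ssc GN). Qed.
Let fv k i : vsqint P (fgr i k). Proof. exact: (fgradv L_gt0 ssc GN). Qed.
Let nv k i : vsqint P (nz i k). Proof. exact: (noise_vsqint GN). Qed.
Let gv k i : vsqint P (sgr i k). Proof. exact: (sgradv L_gt0 ssc GN). Qed.
Let bv k : vsqint P (xbar k). Proof. by apply: vsqint_avg => i; exact: xv. Qed.
Let dv k i c : vsqint P (fun w => x i k w - c).
Proof. by apply: vsqintB; [exact: xv|exact: vsqint_cst]. Qed.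
Let dbv k i : vsqint P (fun w => x i k w - xbar k w).
Proof. by apply: vsqintB; [exact: xv|exact: bv]. Qed.
Let bsv k : vsqint P (fun w => xbar k w - xs).
Proof. by apply: vsqintB; [exact: bv|exact: vsqint_cst]. Qed.

Let isq (u : T -> 'cV[R]_p) : vsqint P u ->
  P.-integrable setT (EFin \o (fun w => dotv (u w) (u w))).
Proof. by move=> su; exact: integrable_dotv. Qed.

Lemma Rintegral_sqr_ge0 (u : T -> 'cV[R]_p) : 0 <= \int[P]_w dotv (u w) (u w).
Proof. by apply: Rintegral_ge0 => w _; exact: dotv_ge0. Qed.

Lemma disp_ge0 k : 0 <= disp k.
Proof. by apply: sumr_ge0 => i _; exact: Rintegral_sqr_ge0. Qed.

Lemma err_split k : err k = disp k + n%:R * bary k.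
Proof.
rewrite /error /dispersion /bary_error -Rintegral_sumr => [|i]; last exact/isq/dv.
under eq_Rintegral do rewrite (sum_sqdist_avg n_gt0) -/(xbar k _).
rewrite RintegralD//; first last.
- by apply: integrableZr; exact/isq/bsv.
- by apply: integrable_sumr => i; exact/isq/dbv.
rewrite RintegralZl//; last exact/isq/bsv.
by rewrite Rintegral_sumr => [|i]; last exact/isq/dbv.
Qed.

Lemma gsq_le k : gsq k <= 2 * L ^+ 2 * err k +
  2 * \sum_i dotv (grad (f i) xs) (grad (f i) xs).
Proof.
rewrite /grad_energy /error !mulr_sumr -big_split; apply: ler_sum => i _ /=.
set c := 2 * dotv (grad (f i) xs) _.
rewrite -RintegralZl//; last exact/isq/dv.
rewrite -(Rintegral_cst1 P c) -RintegralD//; first last.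
- exact: integrable_cstr.
- by apply: integrableZr; exact/isq/dv.
apply: le_Rintegral => //; first exact/isq/fv.
- apply: integrableDr; last exact: integrable_cstr.
  by apply: integrableZr; exact/isq/dv.
- by move=> w _; exact: (grad_sqr_le ssc).
Qed.

Lemma succE k i w : x i k.+1 w = \sum_j W i j *: (x j k w - alpha k *: sgr j k w).
Proof. by []. Qed.

Let yv k j : vsqint P (fun w => x j k w - alpha k *: sgr j k w).
Proof. by apply: vsqintB; [exact: xv|apply: vsqintZ; exact: gv]. Qed.

(** The unbiased noise adds its variance, whose part proportional to the squared
    gradient is handed to the deterministic estimate. *)
Lemma agent_expectation k j : alpha k * (2 * (1 + M) * L ^+ 2) <= mu ->
  \int[P]_w dotv (x j k w - alpha k *: sgr j k w - xs)
                 (x j k w - alpha k *: sgr j k w - xs) <=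
  (1 - alpha k * mu / 2) * \int[P]_w dotv (x j k w - xs) (x j k w - xs)
  + alpha k * (2 / mu + mu / L ^+ 2) * dotv (grad (f j) xs) (grad (f j) xs)
  + alpha k ^+ 2 * sigma ^+ 2.
Proof.
move=> small.
pose u w := x j k w - xs - alpha k *: fgr j k w.
have uv : vsqint P u by apply: vsqintB; [exact: dv|apply: vsqintZ; exact: fv].
have au : adp k u.
  apply: adaptedB; last by apply: adaptedZ; exact: (adapted_fgrad GN).
  by apply: adaptedB; [exact: adapted_iterate|exact: adapted_cst].
have a0 := alpha_gt0 k.
have e1 w : x j k w - alpha k *: sgr j k w - xs = u w - alpha k *: nz j k w.
  rewrite (sgradient_split f) scalerDr opprD addrA [LHS]addrAC; congr (_ - _).
  by rewrite addrAC.
under eq_Rintegral do rewrite e1.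
rewrite (Rintegral_sqr_orthogonal _ uv (nv k j)); last first.
  exact: (noise_orthogonal_adapted L_gt0 ssc GN).
have noise_le := ler_wpM2l (sqr_ge0 (alpha k)) (noise_variance L_gt0 ssc GN j k).
apply: (le_trans (lerD (lexx _) noise_le)).
set df := fun w => fgr j k w.
have iuu := isq uv; have iff := isq (fv k j); have idd := isq (dv k j xs).
have ium : P.-integrable setT (EFin \o (fun w => alpha k ^+ 2 * M * dotv (df w) (df w))).
  exact: integrableZr.
set c := alpha k * _ * dotv (grad (f j) xs) _.
have int_le : \int[P]_w (dotv (u w) (u w) + alpha k ^+ 2 * M * dotv (df w) (df w)) <=
    \int[P]_w ((1 - alpha k * mu / 2) * dotv (x j k w - xs) (x j k w - xs) + c).
  apply: le_Rintegral => //; first exact: integrableDr.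
    by apply: integrableDr; [exact: integrableZr|exact: integrable_cstr].
  move=> w _; have := agent_step_le ssc mu_gt0 L_gt0 xs (ltW a0) j (x j k w) (ltW M_gt0) small.
  have -> : dotv (u w) (u w) = dotv (x j k w - xs) (x j k w - xs) -
      2 * alpha k * dotv (df w) (x j k w - xs) + alpha k ^+ 2 * dotv (df w) (df w).
    by rewrite /u (dotv_sqrB (x j k w - xs)) !(dotvZl, dotvZr) (dotvC (x j k w - xs)); ring.
  by rewrite -/c -/(fgr j k w) -/(df w); lra.
move: int_le; rewrite RintegralD// RintegralD//; first last.
- exact: integrable_cstr.
- exact: integrableZr.
rewrite Rintegral_cst1 !RintegralZl//.
lra.
Qed.

Lemma err_step k : alpha k * (2 * (1 + M) * L ^+ 2) <= mu ->
  err k.+1 <= (1 - alpha k * mu / 2) * err k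
  + alpha k * (2 / mu + mu / L ^+ 2) * (\sum_i dotv (grad (f i) xs) (grad (f i) xs))
  + alpha k ^+ 2 * (n%:R * sigma ^+ 2).
Proof.
move=> small.
have step : err k.+1 <= \sum_j \int[P]_w
    dotv (x j k w - alpha k *: sgr j k w - xs) (x j k w - alpha k *: sgr j k w - xs).
  have yxv j : vsqint P (fun w => x j k w - alpha k *: sgr j k w - xs).
    by apply: vsqintB; [exact: yv|exact: vsqint_cst].
  rewrite /error -!Rintegral_sumr; first last.
  - by move=> i; exact/isq/dv.
  - by move=> i; exact/isq/yxv.
  apply: le_Rintegral => //.
  - by apply: integrable_sumr => i; exact/isq/dv.
  - by apply: integrable_sumr => i; exact/isq/yxv.
  - move=> w _; under eq_bigr do rewrite succE.
    exact: (mixing_sqdist_le mW (fun j => x j k w - alpha k *: sgr j k w)).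
apply: (le_trans step).
apply: (@le_trans _ _ (\sum_j ((1 - alpha k * mu / 2)
      * \int[P]_w dotv (x j k w - xs) (x j k w - xs)
    + alpha k * (2 / mu + mu / L ^+ 2) * dotv (grad (f j) xs) (grad (f j) xs)
    + alpha k ^+ 2 * sigma ^+ 2))).
  by apply: ler_sum => j _; exact: agent_expectation.
rewrite !big_split/= -!mulr_sumr sumr_const card_ord -[_ *+ n]mulr_natl.
by rewrite -/(err k) (mulrCA n%:R).
Qed.

Lemma sgrad_sqr_le k : \sum_j \int[P]_w dotv (sgr j k w) (sgr j k w) <=
  2 * (1 + M) * gsq k + 2 * (n%:R * sigma ^+ 2).
Proof.
have h j : \int[P]_w dotv (sgr j k w) (sgr j k w) <=
    2 * (1 + M) * \int[P]_w dotv (fgr j k w) (fgr j k w) + 2 * sigma ^+ 2.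
  have iff := isq (fv k j); have inn := isq (nv k j).
  apply: (@le_trans _ _ (\int[P]_w (2 * dotv (fgr j k w) (fgr j k w)
      + 2 * dotv (nz j k w) (nz j k w)))).
    apply: le_Rintegral => //; first exact/isq/gv.
      by apply: integrableDr; exact: integrableZr.
    by move=> w _; rewrite (sgradient_split f); exact: dotv_sqrD_le.
  rewrite RintegralD//; [|exact: integrableZr|exact: integrableZr].
  rewrite !RintegralZl//.
  by have := noise_variance L_gt0 ssc GN j k; lra.
apply: (@le_trans _ _ (\sum_j (2 * (1 + M)
    * (\int[P]_w dotv (fgr j k w) (fgr j k w)) + 2 * sigma ^+ 2))).
  by apply: ler_sum => j _; exact: h.
rewrite big_split/= -mulr_sumr sumr_const card_ord -[_ *+ n]mulr_natl.
by rewrite -/(gsq k) (mulrCA n%:R).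
Qed.

(** The stochastic gradients may enter through their second moments alone, since
    the dispersion that they create is of second order in the step size. *)
Lemma disp_step k : rho_w W < 1 ->
  disp k.+1 <= rho_w W * disp k
  + alpha k ^+ 2 / (1 - rho_w W) * (2 * (1 + M) * gsq k + 2 * (n%:R * sigma ^+ 2)).
Proof.
move=> rho1; have rho0 : 0 <= rho_w W by exact: spectral_norm_ge0.
have igg j := isq (gv k j); have idb j := isq (dbv k j).
have isum : P.-integrable setT (EFin \o (fun w => \sum_j (rho_w W *
    dotv (x j k w - xbar k w) (x j k w - xbar k w) +
    alpha k ^+ 2 / (1 - rho_w W) * dotv (sgr j k w) (sgr j k w)))).
  by apply: integrable_sumr => j; apply: integrableDr; exact: integrableZr.
have step : disp k.+1 <= \int[P]_w \sum_j (rho_w W *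
    dotv (x j k w - xbar k w) (x j k w - xbar k w) +
    alpha k ^+ 2 / (1 - rho_w W) * dotv (sgr j k w) (sgr j k w)).
  rewrite /dispersion -Rintegral_sumr => [|i]; last exact/isq/dbv.
  apply: le_Rintegral => //.
    by apply: integrable_sumr => i; exact/isq/dbv.
  move=> w _; pose y j := x j k w - alpha k *: sgr j k w.
  have -> : xbar k.+1 w = avg y by exact: (avg_mixing mW y).
  apply: (le_trans (consensus_contract y (xbar k w) n_gt0 mW)).
  rewrite mulr_sumr; apply: ler_sum => j _.
  by rewrite /y addrAC; exact: rho_young.
apply: (le_trans step); rewrite Rintegral_sumr; last first.
  by move=> j; apply: integrableDr; exact: integrableZr.
under eq_bigr => j _.
  rewrite RintegralD//; [|exact: integrableZr|exact: integrableZr].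
  rewrite !RintegralZl//.
  over.
rewrite big_split/= -!mulr_sumr -/(disp k) lerD2l.
apply: ler_wpM2l; last exact: sgrad_sqr_le.
by rewrite divr_ge0 ?sqr_ge0 ?subr_ge0 ?ltW.
Qed.

(** The variance reduction by averaging: the cross terms vanish by conditional
    independence, so that n^2 terms become n. This is the source of the factor
    1/n in the rate. *)
Lemma noise_avg_sqr k :
  \int[P]_w dotv (avg (fun i => nz i k w)) (avg (fun i => nz i k w)) =
  n%:R ^- 2 * \sum_i \int[P]_w dotv (nz i k w) (nz i k w).
Proof.
have e1 w : dotv (avg (fun i => nz i k w)) (avg (fun i => nz i k w)) =
    n%:R ^- 2 * \sum_i \sum_j dotv (nz i k w) (nz j k w).
  rewrite /avg dotvZl dotvZr mulrA -invfM -expr2; congr (_ * _).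
  rewrite dotv_suml; apply: eq_bigr => i _.
  by rewrite dotvC dotv_suml; apply: eq_bigr => j _; rewrite dotvC.
under eq_Rintegral do rewrite e1.
have inn i j : P.-integrable setT (EFin \o (fun w => dotv (nz i k w) (nz j k w))).
  exact: integrable_dotv.
rewrite RintegralZl//; last by do 2!(apply: integrable_sumr => ?).
congr (_ * _); rewrite Rintegral_sumr => [|i]; last by apply: integrable_sumr => ?.
apply: eq_bigr => i _; rewrite Rintegral_sumr// (bigD1 i)//= big1 ?addr0// => j ji.
by apply: (noise_orthogonal L_gt0 ssc GN); rewrite eq_sym.
Qed.

(** W preserves barycentres, so the barycentre follows a stochastic gradient step
    whose direction is the average of the agents' directions. *)
Lemma bary_step k (eps : R) : \sum_i grad (f i) xs = 0 -> 0 < eps ->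
  alpha k * L ^+ 2 <= 2 * mu ->
  bary k.+1 <= (1 - 2 * alpha k * mu + alpha k ^+ 2 * L ^+ 2 + eps * alpha k * mu)
      * bary k
  + (alpha k ^+ 2 + alpha k / (eps * mu)) * (L ^+ 2 / n%:R) * disp k
  + alpha k ^+ 2 / n%:R ^+ 2 * (n%:R * sigma ^+ 2 + M * gsq k).
Proof.
move=> g0 e0 small; have a0 := alpha_gt0 k.
pose fb w := avg (fun i => fgr i k w); pose nb w := avg (fun i => nz i k w).
have fbv : vsqint P fb by apply: vsqint_avg => i; exact: fv.
have nbv : vsqint P nb by apply: vsqint_avg => i; exact: nv.
pose u w := xbar k w - xs - alpha k *: fb w.
have uv : vsqint P u by apply: vsqintB; [exact: bsv|exact: vsqintZ].
have au : adp k u.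
  apply: adaptedB; last first.
    by apply: adaptedZ; apply: adapted_avg => i; exact: (adapted_fgrad GN).
  apply: adaptedB; last exact: adapted_cst.
  by apply: adapted_avg => i; exact: adapted_iterate.
have e1 w : xbar k.+1 w - xs = u w - alpha k *: nb w.
  have -> : xbar k.+1 w = avg (fun j => x j k w - alpha k *: sgr j k w).
    exact: (avg_mixing mW).
  rewrite /u /fb /nb /barycentre /avg.
  under eq_bigr do rewrite (sgradient_split f).
  rewrite sumrB -scaler_sumr big_split/= scalerBr !scalerDr opprD.
  rewrite ![n%:R^-1 *: (alpha k *: _)]scalerA ![_^-1 * alpha k]mulrC -!scalerA.
  by rewrite addrA [LHS]addrAC; congr (_ - _); rewrite addrAC.
have orth : \int[P]_w dotv (u w) (nb w) = 0.
  have e2 w : dotv (u w) (nb w) = n%:R^-1 * \sum_i dotv (u w) (nz i k w).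
    by rewrite dotvZr dotvC dotv_suml; under eq_bigr do rewrite dotvC.
  under eq_Rintegral do rewrite e2.
  have iun i : P.-integrable setT (EFin \o (fun w => dotv (u w) (nz i k w))).
    exact: integrable_dotv.
  rewrite RintegralZl//; last exact: integrable_sumr.
  rewrite Rintegral_sumr// big1 ?mulr0// => i _.
  exact: (noise_orthogonal_adapted L_gt0 ssc GN).
rewrite /bary_error; under eq_Rintegral do rewrite e1.
rewrite (Rintegral_sqr_orthogonal _ uv nbv orth); apply: lerD; last first.
  rewrite noise_avg_sqr mulrA; apply: ler_wpM2l.
    by rewrite mulr_ge0 ?sqr_ge0// invr_ge0 sqr_ge0.
  apply: (@le_trans _ _ (\sum_i (sigma ^+ 2
      + M * \int[P]_w dotv (fgr i k w) (fgr i k w)))).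
    by apply: ler_sum => i _; exact: (noise_variance L_gt0 ssc GN).
  by rewrite big_split/= sumr_const card_ord -[_ *+ n]mulr_natl -mulr_sumr.
have ib := isq (bsv k).
have is_ : P.-integrable setT (EFin \o (fun w =>
    \sum_i dotv (x i k w - xbar k w) (x i k w - xbar k w))).
  by apply: integrable_sumr => i; exact/isq/dbv.
rewrite /dispersion -Rintegral_sumr => [|i]; last exact/isq/dbv.
rewrite -!RintegralZl// -RintegralD//; [|exact: integrableZr|exact: integrableZr].
apply: le_Rintegral => //; first exact: isq.
  by apply: integrableDr; exact: integrableZr.
by move=> w _; exact: (average_step_le ssc mu_gt0 L_gt0 (ltW a0)).
Qed.

Lemma err0 : err 0%N = \sum_i dotv (x0 i - xs) (x0 i - xs).
Proof.
apply: eq_bigr => i _; have := Rintegral_cst1 P (dotv (x0 i - xs) (x0 i - xs)).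
exact.
Qed.

Lemma err_expectation k :
  ((n%:R^-1)%:E * \sum_(i < n) 'E_P[fun w => (enorm (x i k w - xs) ^+ 2)%R]
   = (n%:R^-1 * err k)%:E)%E.
Proof.
rewrite EFinM /error -sumEFin; congr (_ * _)%E; apply: eq_bigr => i _.
rewrite unlock /Rintegral fineK; last by apply: integrable_fin_num => //; exact/isq/dv.
by apply: eq_integral => w _; rewrite enorm_sqr.
Qed.

End Recursion.

(** * The transient time *)

Theorem corollary2 (R : realType) (theta mu L sigma M a b : R)
    (theta_gt2 : 2 < theta) (mu_gt0 : 0 < mu) (L_gt0 : 0 < L)
    (sigma_gt0 : 0 < sigma) (M_gt0 : 0 < M) (a_gt0 : 0 < a) (b_gt0 : 0 < b) :
  exists C C' : R, 0 < C /\ 0 < C' /\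
  forall (n p m : nat), (0 < n)%N -> (0 < p)%N -> (0 < m)%N ->
  forall (f : 'I_n -> 'cV[R]_p -> R) (xs : 'cV[R]_p)
    (e : rel 'I_n) (W : 'M[R]_n)
    (d : measure_display) (T : measurableType d) (P : probability T R)
    (g : 'I_n -> 'cV[R]_p -> 'cV[R]_m -> 'cV[R]_p)
    (x0 : 'I_n -> 'cV[R]_p) (xi : 'I_n -> nat -> T -> 'cV[R]_m),
  let x := dsgd W (stepsize theta mu L M) g x0 xi in
  (forall i, smooth_strongly_convex mu L (f i)) ->
  is_minimizer (avg_fun f) xs ->
  connected_graph e ->
  mixing_matrix e W ->
  rho_w W < 1 ->
  gradient_noise P f g x xi sigma M ->
  \sum_(i < n) enorm (x0 i - xs) ^+ 2 <= a * n%:R ->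
  \sum_(i < n) enorm (grad (f i) xs) ^+ 2 <= b * n%:R ->
  forall k : nat, C * (n%:R / (1 - rho_w W) ^+ 2) <= k%:R ->
  ((n%:R^-1)%:E * \sum_(i < n) 'E_P[fun w => (enorm (x i k w - xs) ^+ 2)%R]
   <= (C' * (theta ^+ 2 * Mbar f xs sigma M
             / ((2 * theta - 1) * n%:R * mu ^+ 2 * k%:R)))%:E)%E.
Proof.
have theta_gt0 : 0 < theta by rewrite (lt_trans _ theta_gt2).
pose K : R := (stepK theta mu L M)%:~R.
have K_large : 2 * theta * (1 + M) * L ^+ 2 / mu ^+ 2 <= K by exact: ceil_ge.
have K_gt0 : 0 < K by apply: lt_le_trans K_large; pos.
exists 1, (rate_cst theta mu L sigma M a b K); split=> //; split.
  exact: rate_cst_gt0.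
move=> n p m n_gt0 p_gt0 _ f xs e W d T P g x0 xi x ssc min _ mW rho1 GN.
under eq_bigr do rewrite enorm_sqr; move=> err0_le.
under eq_bigr do rewrite enorm_sqr; move=> grad_le k; rewrite mul1r => k_large.
have alE j : stepsize theta mu L M j = theta / (mu * (j%:R + K)) by [].
have al_gt0 j : 0 < stepsize theta mu L M j.
  by rewrite alE; have := shift_gt0 K_gt0 j => s0; pos.
have grad0 := sum_grad_minimizer ssc n_gt0 min.
rewrite (err_expectation L_gt0 ssc GN) lee_fin.
have step_small j := step_small theta_gt2 mu_gt0 M_gt0 K_gt0 K_large j.
rewrite /Mbar; under [in leRHS]eq_bigr do rewrite enorm_sqr.
apply: (dsgd_rate theta_gt2 mu_gt0 L_gt0 sigma_gt0 M_gt0 a_gt0 b_gt0 K_gt0 K_large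
  (S := error P x xs) (V := dispersion P x) (U := bary_error P x xs)
  (G := grad_energy P f x)
  (rho := rho_w W)) => //.
- by rewrite ler1n.
- exact: spectral_norm_ge0.
- exact: (mu_le_L ssc L_gt0 n_gt0 p_gt0).
- by apply: sumr_ge0 => i _; exact: dotv_ge0.
- by rewrite err0.
- by move=> j; exact: disp_ge0.
- by move=> j; exact: Rintegral_sqr_ge0.
- by move=> j; exact: (err_split n_gt0 L_gt0 ssc GN).
- by move=> j; exact: (gsq_le L_gt0 ssc GN).
- by move=> j; exact: (err_step mu_gt0 L_gt0 M_gt0 ssc mW GN al_gt0 (step_small j)).
- by move=> j; exact: (disp_step n_gt0 L_gt0 ssc mW GN).
move=> j eps eps_gt0; apply: (bary_step n_gt0 mu_gt0 L_gt0 ssc mW GN) => //.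
apply: (@le_trans _ _ (stepsize theta mu L M j * (2 * (1 + M) * L ^+ 2))).
  apply: ler_wpM2l; first exact: ltW (al_gt0 j).
  by rewrite ler_peMl ?sqr_ge0//; lra.
by apply: le_trans (step_small j) _; lra.
Qed.
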